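(* Let $H$ be a separable $\mathbb{K}$-Hilbert space, $\mathbb{K}\in\{\mathbb{R},\mathbb{C}\}$, let $A$ be a densely defined symmetric operator on $H$, and let $S=(H_n,A_n,\Omega_n,(e_j^{(n)},c_j^{(n)})_{j=1}^{N_n})_{n\in\mathbb{N}}$ be a convergent $A$-sampling-scale sequence, with associated probability measure $\hat\mu$ on $\mathrm{Borel}(Q)$ and associated isometry $\hat U:H\to L_2(Q,\hat\mu)$. Then there exists a unique real-valued $\hat m\in L_2(Q,\hat\mu)$ such that for any $x\in\mathrm{dom}(A)$, $\hat U(Ax)=\hat m\cdot\hat U(x)$ as elements of $L_2(Q,\hat\mu)$.
   Context: $\mathbb{N}=\{1,2,\dots\}$; inner products are linear in the first argument. A sequence $(H_n,A_n,\Omega_n)_{n\in\mathbb{N}}$ is a sampling sequence for $A$ if for each $n$: $H_n$ is a subspace of $H$ with $\dim(H_n)\in\mathbb{N}$; $A_n:H_n\to H_n$ is a symmetric linear operator; $\Omega_n$ is an orthonormal eigenbasis of $A_n$; and for any $x\in\mathrm{dom}(A)$ there are $x_n\in H_n$ with $x_n\to x$ and $A_nx_n\to Ax$. A low-dimensional-biased scale is a sequence $((e_j^{(n)},c_j^{(n)})_{j=1}^{N_n})_{n\in\mathbb{N}}$ with $N_n\in\mathbb{N}$, $e_j^{(n)}\in H\setminus\{0\}$, $c_j^{(n)}>0$, $\sum_{j=1}^{N_n}c_j^{(n)}\|e_j^{(n)}\|^2=1$ for each $n$, and: $N_n\to\infty$; for each $j\in\mathbb{N}$ the limits $e_j:=\lim_n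 e_j^{(n)}\in H\setminus\{0\}$ and $c_j:=\lim_n c_j^{(n)}\in\mathbb{R}_{>0}$ exist; $\{e_j\}_{j\in\mathbb{N}}$ spans a dense subspace of $H$; $\sum_{j\in\mathbb{N}}c_j\|e_j\|^2=1$. $S=(H_n,A_n,\Omega_n,(e_j^{(n)},c_j^{(n)})_{j=1}^{N_n})_{n\in\mathbb{N}}$ is an $A$-sampling-scale sequence if $(H_n,A_n,\Omega_n)_n$ is a sampling sequence for $A$, $((e_j^{(n)},c_j^{(n)})_j)_n$ is a low-dimensional-biased scale, $e_j^{(n)}\in H_n$ for all $n$ and $j\le N_n$, there is $C\in\mathbb{R}$ with $\sum_{j=1}^{N_n}c_j^{(n)}\|A_ne_j^{(n)}\|^2<C$ for all $n$, and for any $n$ and $f\in\Omega_n$ there is $j\le N_n$ with $\langle e_j^{(n)},f\rangle\ne0$. Given such $S$: $\mu_n$ is the probability measure on the finite set $\Omega_n$ with $\mu_n(\{f\})=\sum_{j=1}^{N_n}c_j^{(n)}|\langle e_j^{(n)},f\rangle|^2>0$. $U_n:H_n\to L_2(\Omega_n,\mu_n)$ is $(U_n(x))(f)=\langle x,f\rangle/\sqrt{\mu_n(\{f\})}$. $Q=\overline{\mathbb{D}}^{\mathbb{N}}$ with the product topology, where $\overline{\mathbb{D}}=\{z\in\mathbb{K}:|z|\le1\}$, with coordinate projections $\pi_j:Q\to\overline{\mathbb{D}}$. $X_n:\Omega_n\to Q$ is given by $\pi_j\circ X_n=\sqrt{c_j^{(n)}}\,U_n(e_j^{(n)})$ if $j\le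 N_n$ and $\pi_j\circ X_n=0$ otherwise. $S$ is convergent if $\left(\int_{\Omega_n}h\circ X_n\,d\mu_n\right)_n$ converges for every continuous $h:Q\to\mathbb{K}$. In that case $\hat\mu$ is the unique probability measure on $\mathrm{Borel}(Q)$ with $\int_Q h\,d\hat\mu=\lim_n\int_{\Omega_n}(h\circ X_n)\,d\mu_n$ for all continuous $h:Q\to\mathbb{K}$, and $\hat U:H\to L_2(Q,\hat\mu)$ is the unique linear isometry such that $\hat U(e_j)=V_j:=\frac{1}{\sqrt{c_j}}\pi_j$ for all $j\in\mathbb{N}$ (such an isometry exists). *)

(* Defs.v *)
From HB Require Import structures.
From mathcomp Require Import all_boot all_order all_algebra finmap.
From mathcomp Require Import all_classical all_reals all_analysis.
From mathcomp Require Import complex.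

Set Implicit Arguments.
Unset Strict Implicit.
Unset Printing Implicit Defensive.

Import Order.TTheory GRing.Theory Num.Theory.
Import numFieldNormedType.Exports.

Local Open Scope classical_set_scope.
Local Open Scope ring_scope.

(* Indices are shifted by one: the sequences indexed by n, j in {1, 2, ...}
   are indexed here by nat, so that "j <= N_n" reads [j < N n]. *)

Variant scalar_kind := RealScalars | ComplexScalars.

Definition scalars (R : realType) (k : scalar_kind) : numFieldType :=
  match k with
  | RealScalars => R
  | ComplexScalars => R[i]
  end.

Section Scalars.
Context {R : realType} {k : scalar_kind}.
Local Notation K := (scalars R k).

Definition toK : R -> K :=
  match k return R -> scalars R k with
  | RealScalars => id
  | ComplexScalars => fun x => (x%:C)%C
  end.

Definition ReK : K -> R :=
  match k return scalars R k -> R with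
  | RealScalars => id
  | ComplexScalars => fun z => complex.Re z
  end.

Definition conjK : K -> K :=
  match k return scalars R k -> scalars R k with
  | RealScalars => id
  | ComplexScalars => fun z => conjc z
  end.

Definition Kintegral d (T : measurableType d)
    (mu : {measure set T -> \bar R}) : (T -> K) -> K :=
  match k return (T -> scalars R k) -> scalars R k with
  | RealScalars => fun f => \int[mu]_t f t
  | ComplexScalars => fun f =>
      ((\int[mu]_t complex.Re (f t)) +i* (\int[mu]_t complex.Im (f t)))%C
  end.

(* The library norm of a normed space over K takes its values in K. *)
Definition rnorm (V : normedZmodType K) (x : V) : R := ReK `|x|.

Lemma toK1 : toK 1 = 1 :> K.
Proof. by rewrite /toK; case: k. Qed.

Lemma toKM (x y : R) : toK (x * y) = toK x * toK y :> K.
Proof. by rewrite /toK; case: k => //=; rewrite rmorphM. Qed.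

Lemma toKV (x : R) : toK x^-1 = (toK x)^-1 :> K.
Proof. by rewrite /toK; case: k => //=; rewrite fmorphV. Qed.

Lemma toK_le (x y : R) : (toK x <= toK y) = (x <= y).
Proof. by rewrite /toK; case: k => //=; rewrite lecR. Qed.

Lemma ReK_ge0 (z : K) : 0 <= z -> z = toK (ReK z) /\ 0 <= ReK z.
Proof.
rewrite /toK /ReK; case: k z => //= -[a b].
by rewrite lecE /= => /andP[/eqP -> a0].
Qed.

Lemma toK_rnorm (V : normedZmodType K) (x : V) : `|x| = toK (rnorm x).
Proof. exact: (ReK_ge0 (normr_ge0 x)).1. Qed.

Lemma rnorm_ge0 (V : normedZmodType K) (x : V) : 0 <= rnorm x.
Proof. exact: (ReK_ge0 (normr_ge0 x)).2. Qed.

Lemma toK_norm (x : R) : 0 <= x -> `|toK x : K| = toK x.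
Proof. by rewrite /toK; case: k => //= x0; rewrite ger0_norm// lecR. Qed.

End Scalars.

Section Cube.
Variables (R : realType) (k : scalar_kind).
Local Notation K := (scalars R k).

Definition closed_disc : Type := set_type [set z : K | `|z| <= 1].

Lemma closed_disc0_subproof : (0 : K) \in [set z : K | `|z| <= 1].
Proof. by rewrite inE /= normr0 ler01. Qed.

Definition closed_disc0 : closed_disc := exist _ 0 closed_disc0_subproof.

HB.instance Definition _ := Topological.on closed_disc.

Definition Q : Type := prod_topology (fun _ : nat => closed_disc).

HB.instance Definition _ := Topological.on Q.
HB.instance Definition _ := isPointed.Build Q (fun=> closed_disc0).

Definition piQ (j : nat) (q : Q) : K := set_val (q j).

Definition borelQ := g_sigma_algebraType (@open Q).
Definition borelK := g_sigma_algebraType (@open K).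

End Cube.

Section L2.
Variables (R : realType) (k : scalar_kind).
Local Notation K := (scalars R k).
Variable mu : probability (borelQ R k) R.

(* {mfun_ mu, _ >-> _} is the type of classes of measurable functions modulo
   almost everywhere equality; it coerces to functions by choosing a
   representative, so pointwise relations between classes are stated almost
   everywhere. *)
Definition L2 : set {mfun_ mu, borelQ R k >-> borelK R k} :=
  [set f | (\int[mu]_q ((rnorm (f q : K)) ^+ 2)%:E < +oo)%E].

Definition L2_real_valued (f : {mfun_ mu, borelQ R k >-> borelK R k}) : Prop :=
  \forall q \ae mu, exists r : R, f q = toK r.

End L2.

Section Operators.
Variables (K : numFieldType) (H : lmodType K).

Definition lin_subspace (V : set H) : Prop :=
  V 0 /\ forall (a : K) (x y : H), V x -> V y -> V (a *: x + y).

Definition lin_span (E : set H) : set H := smallest lin_subspace E.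

Definition has_dim (V : set H) (d : nat) : Prop :=
  exists b : 'I_d -> H,
    (forall a : 'I_d -> K, \sum_(i < d) a i *: b i = 0 -> forall i, a i = 0) /\
    lin_span (range b) = V.

(* An operator with domain D is a total function considered on D only. *)
Definition linear_on (D : set H) (T : H -> H) : Prop :=
  lin_subspace D /\
  forall (a : K) (x y : H), D x -> D y -> T (a *: x + y) = a *: T x + T y.

Definition symmetric_on (dot : H -> H -> K) (D : set H) (T : H -> H) : Prop :=
  forall x y, D x -> D y -> dot (T x) y = dot x (T y).

Record orthonormal_eigenbasis (dot : H -> H -> K) (V : set H) (T : H -> H)
    (B : {fset H}) : Prop := {
  eigenbasis_orthonormal :
    forall f g, f \in B -> g \in B -> dot f g = (f == g)%:R ;
  eigenbasis_eigen : forall f, f \in B -> exists lambda : K, T f = lambda *: f ;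
  eigenbasis_span : lin_span [set` B] = V }.

End Operators.

Definition separable (T : topologicalType) : Prop :=
  exists E : set T, countable E /\ dense E.

Section SamplingScale.
Variables (R : realType) (k : scalar_kind).
Local Notation K := (scalars R k).
Variables (H : completeNormedModType K) (dot : {dot H for @conjK R k}).

Record sampling_sequence (D : set H) (A : H -> H)
    (Hn : nat -> set H) (An : nat -> H -> H) (Omega : nat -> {fset H}) : Prop := {
  sampling_subspace : forall n, lin_subspace (Hn n) ;
  sampling_dim : forall n, exists2 d, (0 < d)%N & has_dim (Hn n) d ;
  sampling_stable : forall n x, Hn n x -> Hn n (An n x) ;
  sampling_linear : forall n, linear_on (Hn n) (An n) ;
  sampling_symmetric : forall n, symmetric_on dot (Hn n) (An n) ;
  sampling_eigenbasis :
    forall n, orthonormal_eigenbasis dot (Hn n) (An n) (Omega n) ;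
  sampling_graph : forall x, D x -> exists x_ : nat -> H,
    [/\ forall n, Hn n (x_ n), x_ n @[n --> \oo] --> x &
        An n (x_ n) @[n --> \oo] --> A x] }.

(* [e n j] and [c n j] are meaningful only for [j < N n]; as N tends to
   infinity, the other values do not affect the limits. *)
Definition lim_e (e : nat -> nat -> H) (j : nat) : H :=
  lim (e n j @[n --> \oo]).

Definition lim_c (c : nat -> nat -> R) (j : nat) : R :=
  lim (c n j @[n --> \oo]).

Record low_dim_biased_scale (N : nat -> nat) (e : nat -> nat -> H)
    (c : nat -> nat -> R) : Prop := {
  scale_N_gt0 : forall n, (0 < N n)%N ;
  scale_e_neq0 : forall n j, (j < N n)%N -> e n j != 0 ;
  scale_c_gt0 : forall n j, (j < N n)%N -> 0 < c n j ;
  scale_sum : forall n, \sum_(j < N n) c n j * rnorm (e n j) ^+ 2 = 1 ;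
  scale_N_cvg : N n @[n --> \oo] --> \oo ;
  scale_e_cvg : forall j, cvg (e n j @[n --> \oo]) ;
  scale_lim_e_neq0 : forall j, lim_e e j != 0 ;
  scale_c_cvg : forall j, cvg (c n j @[n --> \oo]) ;
  scale_lim_c_gt0 : forall j, 0 < lim_c c j ;
  scale_dense : dense (lin_span (range (lim_e e))) ;
  scale_series :
    series (fun j => lim_c c j * rnorm (lim_e e j) ^+ 2) @ \oo --> (1 : R) }.

Record sampling_scale_sequence (D : set H) (A : H -> H) := SamplingScaleSequence {
  ss_H : nat -> set H ;
  ss_A : nat -> H -> H ;
  ss_Omega : nat -> {fset H} ;
  ss_N : nat -> nat ;
  ss_e : nat -> nat -> H ;
  ss_c : nat -> nat -> R ;
  ss_sampling : sampling_sequence D A ss_H ss_A ss_Omega ;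
  ss_scale : low_dim_biased_scale ss_N ss_e ss_c ;
  ss_e_in : forall n j, (j < ss_N n)%N -> ss_H n (ss_e n j) ;
  ss_bounded : exists C : R, forall n,
    \sum_(j < ss_N n) ss_c n j * rnorm (ss_A n (ss_e n j)) ^+ 2 < C ;
  ss_nondegenerate : forall n f, f \in ss_Omega n ->
    exists2 j, (j < ss_N n)%N & dot (ss_e n j) f != 0 }.

Section Associated.
Variables (D : set H) (A : H -> H) (S : sampling_scale_sequence D A).

(* [mass], [U_n] and [X_n] are total in f : H; only f in Omega_n matters.
   [mass n f] is mu_n({f}), and the integral against the finitely supported
   measure mu_n is a finite sum. *)
Definition mass (n : nat) (f : H) : R :=
  \sum_(j < ss_N S n) ss_c S n j * rnorm (dot (ss_e S n j) f) ^+ 2.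

Definition integral_Omega (n : nat) (g : H -> K) : K :=
  \sum_(f <- ss_Omega S n) toK (mass n f) * g f.

Definition U_n (n : nat) (x f : H) : K := dot x f / toK (Num.sqrt (mass n f)).

Definition coord_X (n : nat) (f : H) (j : nat) : K :=
  if (j < ss_N S n)%N then
    toK (Num.sqrt (ss_c S n j)) * U_n n (ss_e S n j) f
  else 0.

Lemma coord_X_disc n f j : coord_X n f j \in [set z : K | `|z| <= 1].
Proof.
rewrite inE /= /coord_X; case: ifPn => [jN|_]; last by rewrite normr0 ler01.
have c0 i : (i < ss_N S n)%N -> 0 < ss_c S n i.
  exact: (scale_c_gt0 (ss_scale S)).
rewrite /U_n !normrM normfV !toK_norm ?sqrtr_ge0// toK_rnorm -toKV -!toKM -toK1.
rewrite toK_le mulrA.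
set r := rnorm _; have r0 : 0 <= r := rnorm_ge0 _.
have -> : Num.sqrt (ss_c S n j) * r = Num.sqrt (ss_c S n j * r ^+ 2).
  by rewrite sqrtrM ?ltW ?c0// sqrtr_sqr ger0_norm.
have le_mass : ss_c S n j * r ^+ 2 <= mass n f.
  rewrite /mass (bigD1 (Ordinal jN))//= lerDl sumr_ge0// => i _.
  by rewrite mulr_ge0 ?sqr_ge0// ltW// c0.
have m0 : 0 <= mass n f.
  by apply: le_trans le_mass; rewrite mulr_ge0 ?sqr_ge0// ltW// c0.
have [m_eq0|m_neq0] := eqVneq (mass n f) 0.
  by rewrite m_eq0 sqrtr0 invr0 mulr0 ler01.
rewrite ler_pdivrMr ?sqrtr_gt0 ?lt0r ?m_neq0// mul1r.
by rewrite ler_wsqrtr.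
Qed.

Definition X_n (n : nat) (f : H) : Q R k :=
  fun j => exist _ (coord_X n f j) (coord_X_disc n f j).

Definition convergent : Prop :=
  forall h : Q R k -> K, continuous h ->
    cvg (integral_Omega n (h \o X_n n) @[n --> \oo]).

Definition associated_measure (mu : probability (borelQ R k) R) : Prop :=
  forall h : Q R k -> K, continuous h ->
    Kintegral mu h = lim (integral_Omega n (h \o X_n n) @[n --> \oo]).

Record associated_isometry (mu : probability (borelQ R k) R)
    (Uhat : H -> {mfun_ mu, borelQ R k >-> borelK R k}) : Prop := {
  isometry_L2 : forall x, L2 (Uhat x) ;
  isometry_linear : forall (a : K) (x y : H),
    \forall q \ae mu, Uhat (a *: x + y) q = a * (Uhat x q : K) + Uhat y q ;
  isometry_norm : forall x,
    (\int[mu]_q ((rnorm (Uhat x q : K)) ^+ 2)%:E = (rnorm x ^+ 2)%:E)%E ;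
  isometry_V : forall j,
    \forall q \ae mu, Uhat (lim_e (ss_e S) j) q =
      (toK (Num.sqrt (lim_c (ss_c S) j)))^-1 * piQ j q }.

End Associated.
End SamplingScale.

(* Main.v *)
Require Import Defs.
From HB Require Import structures.
From mathcomp Require Import all_boot all_order all_algebra finmap.
From mathcomp Require Import all_classical all_reals all_analysis.
From mathcomp Require Import measurable_realfun.
From mathcomp Require Import complex ring lra.

Set Implicit Arguments.
Unset Strict Implicit.
Unset Printing Implicit Defensive.

Import Order.TTheory GRing.Theory Num.Theory.
Import numFieldNormedType.Exports.

Local Open Scope classical_set_scope.
Local Open Scope ring_scope.

(** Existence. On [Omega_n] the operator [A_n] acts as multiplication by its
    real eigenvalues, whose second moments against [mu_n] are bounded by Bessel's
    inequality. The functionals [h |-> int (eigenvalue * (h o X_n)) dmu_n] on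
    bounded continuous real functions therefore converge along an ultrafilter
    to a functional that is bounded in [L2(mu)]; the Riesz representation yields
    a real [m] in [L2(mu)]. A weakly convergent factor paired with a strongly
    convergent one passes to the limit, so testing
    [U_n (A_n x_n) = eigenvalue * U_n x_n] against bounded continuous functions
    gives [Uhat (A x) = m * Uhat x], first for real parts, then, replacing [x]
    by [i x], for both parts.

    Uniqueness. Two multipliers differ only where every [Uhat x], [x] in [dom A],
    vanishes, hence by density where all coordinates [pi_j] vanish. That set is
    null, because [sum_j |pi_j|^2 <= 1] almost everywhere while its integral is
    [sum_j c_j |e_j|^2 = 1]. *)

(** * Square integrable functions *)

(** Evaluate at the vertex [- b / a]. Both Cauchy-Schwarz inequalities and the variational estimate
    in the Riesz argument come from this discriminant bound. *)
Lemma sqr_le_of_quadratic_ge0 (R : realFieldType) (a b c : R) :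
  0 <= a -> (forall t, 0 <= a * t ^+ 2 + 2 * b * t + c) -> b ^+ 2 <= a * c.
Proof.
move=> a0 h; have [a_eq0|a_neq0] := eqVneq a 0.
  rewrite a_eq0 mul0r; have [->|b0] := eqVneq b 0; first by rewrite expr0n.
  (* At this argument the affine function takes the value -1. *)
  have := h (- (c + 1) / (2 * b)).
  rewrite a_eq0 mul0r add0r.
  rewrite mulrC divfK ?mulf_neq0 ?pnatr_eq0//; lra.
have a_gt0 : 0 < a by rewrite lt0r a_neq0.
have := h (- b / a).
have -> : a * (- b / a) ^+ 2 + 2 * b * (- b / a) + c = (a * c - b ^+ 2) / a.
  by field.
by rewrite pmulr_lge0 ?invr_gt0// subr_ge0.
Qed.

Section SquareIntegrable.
Context d (T : measurableType d) (R : realType) (mu : probability T R).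
Implicit Types f g h : T -> R.

(** A predicate on functions, not on classes modulo null sets: sums and products stay pointwise, and
    the multiplier becomes a class only at the very end. *)
Definition sqint f := measurable_fun setT f /\
  mu.-integrable setT (EFin \o (fun x => f x ^+ 2)).

Lemma eq_Rintegral_setT f g : f =1 g -> \int[mu]_x f x = \int[mu]_x g x.
Proof. by move=> fg; apply: eq_Rintegral => x _. Qed.

Lemma Rintegral_cst_setT (c : R) : \int[mu]_x c = c.
Proof.
by rewrite Rintegral_cst// [X in fine X](_ : _ = 1%E) ?mulr1//; exact: probability_setT.
Qed.

(** Domination by [f ^ 2 + g ^ 2], since the square of [|f| - |g|] is nonnegative. *)
Lemma sqintM f g : sqint f -> sqint g ->
  mu.-integrable setT (EFin \o (fun x => f x * g x)).
Proof.
move=> [mf f2] [mg g2]; apply: (le_integrable measurableT _ _ (integrableD measurableT f2 g2)).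
  by apply/measurable_EFinP; exact: measurable_funM.
move=> x _ /=; rewrite lee_fin normrM (ger0_norm (addr_ge0 _ _)) ?sqr_ge0//.
have := sqr_ge0 (`|f x| - `|g x|); rewrite -(real_normK (num_real (f x))).
rewrite -(real_normK (num_real (g x))) => h.
have := normr_ge0 (f x); have := normr_ge0 (g x); nra.
Qed.

Lemma sqintE f : measurable_fun setT f ->
  (\int[mu]_x (f x ^+ 2)%:E < +oo)%E -> sqint f.
Proof.
move=> mf fi; split=> //; apply/integrableP; split.
  by apply/measurable_EFinP; exact: measurable_funX.
under eq_integral do rewrite /= ger0_norm ?sqr_ge0//.
exact: fi.
Qed.

Lemma sqint_integral f : sqint f ->
  (\int[mu]_x (f x ^+ 2)%:E)%E = (\int[mu]_x (f x ^+ 2))%:E.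
Proof. by move=> [_ fi]; rewrite /Rintegral fineK// integrable_fin_num. Qed.

Lemma sqintZD (a : R) f g : sqint f -> sqint g -> sqint (fun x => a * f x + g x).
Proof.
move=> sf sg; have [mf f2] := sf; have [mg g2] := sg.
have fg := sqintM sf sg; split.
  by apply: measurable_funD => //; apply: measurable_funM.
have h1 := integrableZl measurableT (a ^+ 2) f2.
have h2 := integrableZl measurableT (2 * a) fg.
have := integrableD measurableT (integrableD measurableT h1 h2) g2.
by apply: eq_integrable => // x _ /=; rewrite -EFinM -!EFinD; congr EFin; ring.
Qed.

Lemma bounded_sqint (M : R) f : measurable_fun setT f ->
  (forall x, `|f x| <= M) -> sqint f.
Proof.
move=> mf fM; split=> //; apply: measurable_bounded_integrable => //.
- by rewrite fin_num_fun_lty//; exact: fin_num_measure.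
- exact: measurable_funX.
exists (M ^+ 2); split; first exact: num_real.
move=> y My x _ /=; rewrite normrX.
by rewrite (le_trans _ (ltW My))// lerXn2r ?nnegrE// (le_trans _ (fM x)).
Qed.

Lemma sqint_cst (c : R) : sqint (fun=> c).
Proof. by apply: (@bounded_sqint `|c|). Qed.

Lemma sqintD f g : sqint f -> sqint g -> sqint (fun x => f x + g x).
Proof.
move=> sf sg; have := sqintZD 1 sf sg.
by under eq_fun do rewrite mul1r.
Qed.

Lemma sqintB f g : sqint f -> sqint g -> sqint (fun x => f x - g x).
Proof.
move=> sf sg; have := sqintZD (-1) sg sf.
by under eq_fun do rewrite mulN1r addrC.
Qed.

Lemma sqint_integrable f : sqint f -> mu.-integrable setT (EFin \o f).
Proof.
move=> sf; have := sqintM sf (sqint_cst 1).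
by apply: eq_integrable => // x _ /=; rewrite mulr1.
Qed.

Lemma sqintMb (M : R) f g : measurable_fun setT f ->
  (forall x, `|f x| <= M) -> sqint g -> sqint (fun x => f x * g x).
Proof.
move=> mf fM [mg g2]; have M0 : 0 <= M := le_trans (normr_ge0 _) (fM point).
split; first exact: measurable_funM.
apply: (le_integrable measurableT _ _ (integrableZl measurableT (M ^+ 2) g2)).
  by apply/measurable_EFinP; apply: measurable_funX; exact: measurable_funM.
move=> x _ /=; rewrite lee_fin ger0_norm ?sqr_ge0// ger0_norm; last first.
  by rewrite mulr_ge0 ?sqr_ge0.
by rewrite exprMn ler_wpM2r ?sqr_ge0// -(real_normK (num_real (f x))) lerXn2r ?nnegrE.
Qed.

(** Written in the coefficient form that [sqr_le_of_quadratic_ge0] expects. *)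
Lemma sqint_quadratic (t : R) f g : sqint f -> sqint g ->
  \int[mu]_x (t * f x + g x) ^+ 2 =
  \int[mu]_x (f x ^+ 2) * t ^+ 2 + 2 * \int[mu]_x (f x * g x) * t
  + \int[mu]_x (g x ^+ 2).
Proof.
move=> sf sg; have [mf f2] := sf; have [mg g2] := sg.
have fg := sqintM sf sg.
have h1 := integrableZl measurableT (t ^+ 2) f2.
have h2 := integrableZl measurableT (2 * t) fg.
transitivity (\int[mu]_x ((t ^+ 2 * f x ^+ 2 + 2 * t * (f x * g x)) + g x ^+ 2)).
  by apply: eq_Rintegral_setT => x; ring.
rewrite RintegralD//; last first.
  exact: (integrableD measurableT h1 h2).
rewrite RintegralD// !RintegralZl//; ring.
Qed.

Lemma Rintegral_sqr_ge0 f : 0 <= \int[mu]_x (f x ^+ 2).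
Proof. by apply: Rintegral_ge0 => x _; exact: sqr_ge0. Qed.

Lemma Cauchy_Schwarz_Rintegral f g : sqint f -> sqint g ->
  (\int[mu]_x (f x * g x)) ^+ 2 <=
  \int[mu]_x (f x ^+ 2) * \int[mu]_x (g x ^+ 2).
Proof.
move=> sf sg; apply: sqr_le_of_quadratic_ge0; first exact: Rintegral_sqr_ge0.
by move=> t; rewrite -sqint_quadratic//; exact: Rintegral_sqr_ge0.
Qed.

End SquareIntegrable.

(** * Completeness of the space of square integrable functions *)

Lemma limn_einf_le (R : realType) (u : (\bar R)^nat) (c : \bar R) (N : nat) :
  (forall n, (N <= n)%N -> (u n <= c)%E) -> (limn_einf u <= c)%E.
Proof.
move=> uc; rewrite limn_einf_lim; apply: lime_le; first exact: is_cvg_einfs.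
near=> n; apply: ereal_inf_le; exists (u (maxn n N)).
  by exists (maxn n N) => //=; exact: leq_maxl.
by apply: uc; exact: leq_maxr.
Unshelve. all: by end_near. Qed.

Section Completeness.
Context d (T : measurableType d) (R : realType) (mu : probability T R).
Implicit Types f g h : T -> R.

(** Cauchy-Schwarz against the constant 1, whose square has integral 1 for a probability measure. *)
Lemma Rintegral_norm_le (c : R) f : 0 <= c -> sqint mu f ->
  \int[mu]_x (f x ^+ 2) <= c ^+ 2 -> \int[mu]_x `|f x| <= c.
Proof.
move=> c0 sf fc.
have snf : sqint mu (fun x => `|f x|).
  split; first by apply: measurableT_comp => //; case: sf.
  by under eq_fun do rewrite real_normK ?num_real//; case: sf.
have := Cauchy_Schwarz_Rintegral snf (sqint_cst mu 1).
under eq_Rintegral do rewrite mulr1.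
under [X in X * _]eq_Rintegral do rewrite real_normK ?num_real//.
rewrite (_ : \int[mu]_x 1 ^+ 2 = 1); last first.
  by rewrite expr1n Rintegral_cst_setT.
rewrite mulr1 => h; have := le_trans h fc.
by rewrite ler_sqr// nnegrE; apply: Rintegral_ge0 => x _.
Qed.

(** The increments have L1 norms at most [2^-1 ^+ i], so the series of their absolute values has
    integral at most 2 and is finite almost everywhere; there the telescoping series converges
    absolutely. *)
Lemma ae_cvg_of_summable (h : nat -> T -> R) : (forall i, sqint mu (h i)) ->
  (forall i, \int[mu]_x ((h i.+1 x - h i x) ^+ 2) <= 4^-1 ^+ i) ->
  {ae mu, forall x, cvgn (h ^~ x)}.
Proof.
move=> sh hh; pose u i x := h i.+1 x - h i x.
have su i : sqint mu (u i) by exact: sqintB.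
have mnu i : measurable_fun setT (fun x => `|u i x|%:E).
  apply/measurable_EFinP; apply: measurableT_comp => //; exact: (su i).1.
have uI i : (\int[mu]_x `|u i x|%:E <= (2^-1 ^+ i)%:E)%E.
  have /integrable_norm/(integrable_fin_num measurableT) fu :=
    sqint_integrable (su i).
  rewrite -(fineK fu) lee_fin.
  apply: Rintegral_norm_le => //.
  rewrite -exprM mulnC exprM (_ : 2^-1 ^+ 2 = 4^-1) ?hh//; lra.
pose g x := (\sum_(i <oo) `|u i x|%:E)%E.
have mg : measurable_fun setT g.
  by apply: ge0_emeasurable_sum => // i x _ _; rewrite lee_fin.
have g0 x : (0 <= g x)%E by apply: nneseries_ge0 => i _ _; rewrite lee_fin.
have Ig : (\int[mu]_x g x <= 2%:E)%E.
  rewrite integral_nneseries//.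
  apply: lime_le.
    by apply: is_cvg_nneseries => i _ _; apply: integral_ge0 => x _; rewrite lee_fin.
  near=> n; apply: (@le_trans _ _ (\sum_(0 <= i < n) (2^-1 ^+ i)%:E)%E).
    exact: lee_sum.
  rewrite sumEFin lee_fin.
  have := @geometric_le_lim R n 1 2^-1 ler01.
  rewrite /series /geometric /= => /(_ _ _).
  under eq_bigr do rewrite mul1r.
  rewrite (_ : 1 - 2^-1 = 2^-1 :> R) ?invrK ?mul1r; last by lra.
  apply; first lra.
  by rewrite ger0_norm; lra.
have ig : mu.-integrable setT g.
  apply/integrableP; split=> //.
  under eq_integral do rewrite gee0_abs//.
  by apply: (le_lt_trans Ig); rewrite ltry.
apply: filterS (integrable_ae measurableT ig) => x /(_ I) gx.
have cu : cvgn (series (fun i => u i x)).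
  apply: normed_cvg; apply: nondecreasing_is_cvgn.
    by apply: nondecreasing_series => n _ _; exact: normr_ge0.
  exists (fine (g x)) => _ [n _ <-].
  rewrite -lee_fin fineK// /series/= -sumEFin.
  by apply: nneseries_lim_ge => i _ _; rewrite lee_fin.
have -> : h ^~ x = fun n => h 0%N x + series (fun i => u i x) n.
  apply/funext => n; rewrite /series/=; elim: n => [|n IH].
    by rewrite big_geq// addr0.
  by rewrite big_nat_recr//= addrA -IH /u addrC subrK.
by apply: is_cvgD => //; exact: is_cvg_cst.
Unshelve. all: by end_near. Qed.

(** The pointwise limit exists almost everywhere, and Fatou's lemma in [j] carries the Cauchy
    estimate over to it. The rate is prescribed so that the increments are summable. *)
Lemma sqint_complete (h : nat -> T -> R) : (forall i, sqint mu (h i)) ->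
  (forall i j, (i <= j)%N -> \int[mu]_x ((h j x - h i x) ^+ 2) <= 4^-1 ^+ i) ->
  exists2 m, sqint mu m &
    forall i, \int[mu]_x ((m x - h i x) ^+ 2) <= 4^-1 ^+ i.
Proof.
(* The upper limit is measurable whether or not the sequence converges, and [fine] makes it real;
   the values on the exceptional null set are immaterial. *)
move=> sh hh; pose m x := fine (limn_esup (fun i => (h i x)%:E)).
have mm : measurable_fun setT m.
  apply: measurableT_comp => //; apply: measurable_fun_limn_esup => i.
  by apply/measurable_EFinP; exact: (sh i).1.
have hm : {ae mu, forall x, h ^~ x @ \oo --> m x}.
  have := ae_cvg_of_summable sh (fun i => hh i i.+1 (leqnSn i)).
  apply: filterS => x /cvg_ex[l hl]; suff -> : m x = l by [].
  have hl' : (h i x)%:E @[i --> \oo] --> l%:E by apply: cvg_EFin => //; exact: nearW.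
  by rewrite /m (cvg_limn_einf_sup hl').2.
have mmh i : measurable_fun setT (fun x => (m x - h i x)).
  by apply: measurable_funB => //; exact: (sh i).1.
have mmhh i j : measurable_fun setT (fun x => ((h j x - h i x) ^+ 2)%:E).
  by apply/measurable_EFinP/measurable_funX/measurable_funB; exact: (sh _).1.
have key i : (\int[mu]_x ((m x - h i x) ^+ 2)%:E <= (4^-1 ^+ i)%:E)%E.
  have -> : (\int[mu]_x ((m x - h i x) ^+ 2)%:E =
      \int[mu]_x limn_einf (fun j => ((h j x - h i x) ^+ 2)%:E))%E.
    apply: ae_eq_integral => //.
    - by apply/measurable_EFinP/measurable_funX.
    - rewrite /limn_einf; apply: (measurableT_comp (f := -%E)) => //.
      apply: measurable_fun_limn_esup => j.
      exact: (measurableT_comp (f := -%E)).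
    apply: filterS hm => x hx _.
    have : ((h j x - h i x) ^+ 2)%:E @[j --> \oo] --> ((m x - h i x) ^+ 2)%:E.
      apply: cvg_EFin; first exact: nearW.
      by apply: cvgM; apply: cvgB => //; exact: cvg_cst.
    by move=> /cvg_limn_einf_sup[-> _].
  apply: (le_trans (fatou _ _ _ _)) => //.
    by move=> n x _; rewrite lee_fin sqr_ge0.
  apply: (limn_einf_le (N := i)) => j ij; rewrite (sqint_integral (sqintB (sh j) (sh i))).
  by rewrite lee_fin hh.
have sd i : sqint mu (fun x => m x - h i x).
  by apply: sqintE => //; apply: le_lt_trans (key i) _; rewrite ltry.
exists m; last by move=> i; rewrite -lee_fin -(sqint_integral (sd i)).
by have := sqintD (sd 0%N) (sh 0%N); under eq_fun do rewrite subrK.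
Qed.

End Completeness.

(** * Riesz representation of a bounded functional on a space of square integrable functions *)

Section Riesz.
Context d (T : measurableType d) (R : realType) (mu : probability T R).
Variables (V : set (T -> R)) (L : (T -> R) -> R) (C : R).
Hypotheses (C0 : 0 <= C) (V0 : V (fun=> 0)) (VZD : forall a f g, V f -> V g ->
  V (fun x => a * f x + g x)).
Hypothesis (Vsq : forall f, V f -> sqint mu f).
Hypothesis LZD : forall a f g, V f -> V g ->
  L (fun x => a * f x + g x) = a * L f + L g.
Hypothesis Lbnd : forall f, V f -> L f ^+ 2 <= C * \int[mu]_x (f x ^+ 2).

(** If [m] represents [L], then [J f] is the square distance from [f] to [m] minus the square norm
    of [m]; minimizing [J] over [V] thus approximates the unknown [m]. *)
Let J f := \int[mu]_x (f x ^+ 2) - 2 * L f.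

(** The bound on [L] gives [|2 L f| <= 2 sqrt (C I) <= C + I], where [I] is the integral of
    [f ^ 2]. *)
Let J_ge f : V f -> - C <= J f.
Proof.
move=> Vf; have := Lbnd Vf; rewrite /J.
set I := \int[mu]_x _; have I0 : 0 <= I by exact: Rintegral_sqr_ge0.
move: (L f) => l h; have hCI := sqr_ge0 (C - I).
have : `|2 * l| <= C + I.
  by rewrite -ler_sqr ?nnegrE ?addr_ge0// real_normK ?num_real//; nra.
by have := ler_norm (2 * l); lra.
Qed.

Let d0 := inf (J @` V).

Let J_has_inf : has_inf (J @` V).
Proof.
split; first by exists (J (fun=> 0)), (fun=> 0).
by exists (- C) => _ [f Vf <-]; exact: J_ge.
Qed.

Let J_ge_inf f : V f -> d0 <= J f.
Proof. by move=> Vf; apply: ge_inf; [case: J_has_inf|exists f]. Qed.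

Let J_quadratic t f g : V f -> V g ->
  J (fun x => t * f x + g x) =
  \int[mu]_x (f x ^+ 2) * t ^+ 2 + 2 * (\int[mu]_x (f x * g x) - L f) * t + J g.
Proof.
move=> Vf Vg; rewrite /J sqint_quadratic ?LZD//; [ring|exact: Vsq|exact: Vsq].
Qed.

(** An approximate Euler equation: [J (t f + g) - d0] is a nonnegative quadratic in [t] with
    constant term at most [e], so the discriminant bounds its linear coefficient. *)
Let variation e f g : V f -> V g -> J g <= d0 + e ->
  (\int[mu]_x (f x * g x) - L f) ^+ 2 <= \int[mu]_x (f x ^+ 2) * e.
Proof.
move=> Vf Vg Jg; apply: sqr_le_of_quadratic_ge0 => [|t].
  exact: Rintegral_sqr_ge0.
have := J_ge_inf (VZD t Vf Vg); rewrite J_quadratic//; lra.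
Qed.

(* The parallelogram identity. *)
Let minimizing_close e e' f g : V f -> V g -> J f <= d0 + e -> J g <= d0 + e' ->
  \int[mu]_x ((f x - g x) ^+ 2) <= 2 * (e + e').
Proof.
move=> Vf Vg Jf Jg.
(* The midpoint of [f] and [g], with the zero function appended to match the closure hypothesis
   [VZD]. *)
have Vh : V (fun x => 2^-1 * f x + (2^-1 * g x + 0)).
  by apply: VZD => //; exact: VZD.
have := J_ge_inf Vh.
rewrite J_quadratic//; last exact: VZD.
have -> : \int[mu]_x (f x * (2^-1 * g x + 0)) = 2^-1 * \int[mu]_x (f x * g x).
  rewrite -RintegralZl//; last exact: (sqintM (Vsq Vf) (Vsq Vg)).
  by apply: eq_Rintegral_setT => x; rewrite addr0; ring.
rewrite (@J_quadratic _ g (fun=> 0))//.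
have -> : \int[mu]_x (g x * 0) = 0.
  under eq_Rintegral do rewrite mulr0.
  by rewrite Rintegral_cst_setT.
have L0 : L (fun=> 0) = 0.
  by have := LZD 1 V0 V0; rewrite !mul1r addr0; lra.
have J0 : J (fun=> 0) = 0.
  rewrite /J L0 mulr0 subr0.
  under eq_Rintegral do rewrite expr0n.
  by rewrite Rintegral_cst_setT.
rewrite J0.
have -> : \int[mu]_x ((f x - g x) ^+ 2) = \int[mu]_x (f x ^+ 2) -
    2 * \int[mu]_x (f x * g x) + \int[mu]_x (g x ^+ 2).
  transitivity (\int[mu]_x ((-1 * g x + f x) ^+ 2)).
    by apply: eq_Rintegral_setT => x; ring.
  rewrite sqint_quadratic; [|exact: Vsq|exact: Vsq].
  rewrite (@eq_Rintegral_setT _ _ _ mu (fun x => g x * f x) (fun x => f x * g x)).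
    by ring.
  by move=> x; rewrite mulrC.
move: Jf Jg; rewrite /J; lra.
Qed.

Lemma Riesz_sqint : exists2 m, sqint mu m &
  forall f, V f -> \int[mu]_x (m x * f x) = L f.
Proof.
(* The factor 1/4 makes [2 * (e j + e i) <= 4^-1 ^+ i] for [i <= j], the rate required by
   [sqint_complete]. *)
pose e i : R := 4^-1 ^+ i / 4.
have e0 i : 0 < e i by rewrite divr_gt0// exprn_gt0// invr_gt0.
have /choice[h hP] i : exists h, V h /\ J h <= d0 + e i.
  have [_ [f Vf <-] fe] := inf_adherent (e0 i) J_has_inf.
  by exists f; split => //; exact: ltW.
have sh i : sqint mu (h i) by apply: Vsq; exact: (hP i).1.
have hh i j : (i <= j)%N -> \int[mu]_x ((h j x - h i x) ^+ 2) <= 4^-1 ^+ i.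
  move=> ij; have [[Vi Ji] [Vj Jj]] := (hP i, hP j).
  apply: (le_trans (minimizing_close Vj Vi Jj Ji)).
  have : 4^-1 ^+ j <= 4^-1 ^+ i :> R by rewrite ler_wiXn2l//; lra.
  rewrite /e; lra.
have [m sm mh] := sqint_complete sh hh.
exists m => // f Vf; have sf := Vsq Vf.
set F := \int[mu]_x (f x ^+ 2).
have F0 : 0 <= F by exact: Rintegral_sqr_ge0.
(* The error is the integral of [(m - h i) * f], bounded by Cauchy-Schwarz, plus that of [f * h i]
   minus [L f], bounded by [variation]; both squares are of order [F * 4^-1 ^+ i]. *)
have bnd i : (\int[mu]_x (m x * f x) - L f) ^+ 2 <= 4 * F * 4^-1 ^+ i.
  have [Vi Ji] := hP i.
  have v1 := variation Vf Vi Ji; rewrite -/F in v1.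
  have smh : sqint mu (fun x => m x - h i x) by exact: sqintB.
  have := Cauchy_Schwarz_Rintegral smh sf; rewrite -/F => v2.
  have : \int[mu]_x (m x * f x) =
      \int[mu]_x ((m x - h i x) * f x) + \int[mu]_x (f x * h i x).
    rewrite -RintegralD//; [|exact: sqintM|exact: sqintM].
    by apply: eq_Rintegral_setT => x; ring.
  move=> ->; move: v1 v2 (mh i); rewrite /e.
  move: (\int[mu]_x (f x * h i x)) (\int[mu]_x ((m x - h i x) * f x)).
  move: (\int[mu]_x ((m x - h i x) ^+ 2)) => G a b v1 v2 v3.
  have := sqr_ge0 (b - (a - L f)).
  have : G * F <= 4^-1 ^+ i * F by rewrite ler_wpM2r.
  have : 0 <= 4^-1 ^+ i * F by rewrite mulr_ge0// exprn_ge0.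
  move: (4^-1 ^+ i) v1 v2 v3 => q; nra.
apply/eqP; rewrite -subr_eq0 -sqrf_eq0 eq_le sqr_ge0 andbT.
have : (4 * F * 4^-1 ^+ i) @[i --> \oo] --> (0 : R).
  rewrite -[X in _ --> X](mulr0 (4 * F)); apply: cvgM; first exact: cvg_cst.
  by apply: cvg_expr; rewrite ger0_norm; lra.
move=> h4; apply/ler_addgt0Pr => eps eps0; rewrite add0r.
have [N _ /(_ N (leqnn N)) hN] := @cvgr_le _ _ _ _ _ _ h4 eps eps0.
exact: (le_trans (bnd N)).
Qed.

End Riesz.

(** * Scalars and Bessel's inequality *)

Section ScalarTheory.
Context {R : realType} {k : scalar_kind}.
Local Notation K := (scalars R k).

Lemma toK_inj : injective (@toK R k).
Proof. by move=> x y xy; apply/le_anti; rewrite -!(@toK_le R k) xy lexx. Qed.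

Lemma toK_lt (x y : R) : (toK x < toK y :> K) = (x < y).
Proof. by rewrite !lt_neqAle toK_le (inj_eq toK_inj). Qed.

Lemma toK0 : toK 0 = 0 :> K.
Proof. by rewrite /toK; case: k. Qed.

Lemma toKD (x y : R) : toK (x + y) = toK x + toK y :> K.
Proof. by rewrite /toK; case: k => //=; rewrite rmorphD. Qed.

Lemma toKX (x : R) n : toK (x ^+ n) = toK x ^+ n :> K.
Proof. by elim: n => [|n IH]; rewrite ?expr0 ?toK1// !exprS toKM IH. Qed.

Lemma toK_sum I (r : seq I) (P : pred I) (F : I -> R) :
  toK (\sum_(i <- r | P i) F i) = \sum_(i <- r | P i) toK (F i) :> K.
Proof. by apply: (big_morph _ toKD toK0). Qed.

Lemma toK_gt0 (x : R) : (0 < toK x :> K) = (0 < x).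
Proof. by rewrite -toK0 toK_lt. Qed.

Lemma toKK (x : R) : ReK (toK x : K) = x.
Proof. by rewrite /ReK /toK; case: k. Qed.

Lemma ReKD (x y : K) : ReK (x + y) = ReK x + ReK y.
Proof. by rewrite /ReK; case: k x y => //= -[a b] [c d]. Qed.

Lemma ReK0 : ReK (0 : K) = 0.
Proof. by rewrite -toK0 toKK. Qed.

Lemma ReK_toKM (r : R) (x : K) : ReK (toK r * x) = r * ReK x.
Proof.
by rewrite /ReK /toK; case: k x => //= -[a b] /=; rewrite mul0r subr0.
Qed.

Lemma ReKN (x : K) : ReK (- x) = - ReK x.
Proof. by rewrite -[- x]add0r; apply/eqP; rewrite -addr_eq0 -ReKD add0r addNr ReK0. Qed.

Lemma ReKB (x y : K) : ReK (x - y) = ReK x - ReK y.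
Proof. by rewrite ReKD ReKN. Qed.

Lemma ReK_gt0 (x : K) : 0 < x -> x = toK (ReK x) /\ 0 < ReK x.
Proof.
by move=> x0; have [xE _] := ReK_ge0 (ltW x0); split=> //; rewrite -toK_gt0 -xE.
Qed.

(** The imaginary unit, with 1 standing in for it over the reals, so that [ReK x] and
    [ReK (imK * x)] determine [x] in both cases. *)
Definition imK : K :=
  match k return scalars R k with
  | RealScalars => 1
  | ComplexScalars => 'i%C
  end.

Lemma ReK_imK_eq0 (x : K) : ReK x = 0 -> ReK (imK * x) = 0 -> x = 0.
Proof.
rewrite /ReK /imK; case: k x => //= -[a b] /= ->.
by rewrite mul0r mul1r add0r => /eqP; rewrite oppr_eq0 => /eqP ->.
Qed.

Section Norm.
Variable V : normedModType K.
Implicit Types x y : V.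

Lemma rnorm0 : rnorm (0 : V) = 0.
Proof. by rewrite /rnorm normr0 ReK0. Qed.

Lemma rnormN x : rnorm (- x) = rnorm x.
Proof. by rewrite /rnorm normrN. Qed.

Lemma rnorm_distC x y : rnorm (x - y) = rnorm (y - x).
Proof. by rewrite /rnorm distrC. Qed.

Lemma ler_rnormD x y : rnorm (x + y) <= rnorm x + rnorm y.
Proof. by rewrite -(@toK_le R k) toKD -!toK_rnorm ler_normD. Qed.

(** Library balls have radii in [K]; a positive element of [K] is real, so real radii suffice. *)
Lemma cvg_rnormP (I : Type) (F : set_system I) {FF : Filter F} (f : I -> V) (l : V) :
  f x @[x --> F] --> l <->
  forall e : R, 0 < e -> \forall x \near F, rnorm (l - f x) < e.
Proof.
split=> [/cvgrPdist_lt fl e e0|fl].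
  have ke : 0 < (toK e : K) by rewrite toK_gt0.
  by apply: filterS (fl _ ke) => x; rewrite toK_rnorm toK_lt.
apply/cvgrPdist_lt => e /ReK_gt0[eE e0]; rewrite eE.
by apply: filterS (fl _ e0) => x; rewrite toK_rnorm toK_lt.
Qed.

End Norm.

Lemma rnormM (x y : K) : rnorm (x * y) = rnorm x * rnorm y.
Proof. by apply: toK_inj; rewrite toKM -!toK_rnorm normrM. Qed.

Lemma rnorm_toK (r : R) : rnorm (toK r : K) = `|r|.
Proof.
by rewrite /rnorm /toK /ReK; case: k => //=; rewrite expr0n addr0 sqrtr_sqr.
Qed.

Lemma normr_ReK (x : K) : `|ReK x| <= rnorm x.
Proof.
rewrite /rnorm /ReK; case: k x => //= -[a b] /=.
by rewrite -sqrtr_sqr ler_wsqrtr// lerDl sqr_ge0.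
Qed.

Lemma cvg_ReK (I : Type) (F : set_system I) {FF : Filter F} (f : I -> K) (l : K) :
  f x @[x --> F] --> l -> ReK (f x) @[x --> F] --> ReK l.
Proof.
move=> /cvg_rnormP fl; apply/cvgrPdist_lt => e e0.
apply: filterS (fl e e0) => y; apply: le_lt_trans.
by rewrite -ReKB normr_ReK.
Qed.

Lemma cvg_toK (I : Type) (F : set_system I) {FF : Filter F} (f : I -> R) (l : R) :
  f x @[x --> F] --> l -> (toK (f x) : K) @[x --> F] --> (toK l : K).
Proof.
move=> /cvgrPdist_lt fl; apply/cvg_rnormP => e e0.
apply: filterS (fl e e0) => y; have -> : toK l - toK (f y) = toK (l - f y) :> K.
  by apply/eqP; rewrite subr_eq -toKD subrK.
by rewrite rnorm_toK.
Qed.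

Lemma ReK_continuous : continuous (@ReK R k : K -> R).
Proof. by move=> x; apply: (@cvg_ReK _ (nbhs x)); exact: cvg_id. Qed.

Lemma toK_continuous : continuous (@toK R k : R -> K).
Proof. by move=> x; apply: (@cvg_toK _ (nbhs x)); exact: cvg_id. Qed.

Lemma rnorm_continuous (V : normedModType K) : continuous (@rnorm R k V : V -> R).
Proof.
move=> x; apply: (@continuous_comp _ _ _ (fun y : V => `|y|) (@ReK R k)).
  exact: norm_continuous.
exact: ReK_continuous.
Qed.

Lemma conjK_toK (r : R) : conjK (toK r : K) = toK r.
Proof. by rewrite /conjK /toK; case: k => //=; rewrite oppr0. Qed.

Lemma conjK_real (x : K) : conjK x = x -> x = toK (ReK x).
Proof.
rewrite /conjK /toK /ReK; case: k x => //= -[a b] /= [] h.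
by congr (_ +i* _)%C; apply/eqP; rewrite -[_ == _](@mulrn_eq0 _ b 2) mulr2n -{1}h addNr.
Qed.

Lemma mulK_conjK (x : K) : x * conjK x = toK (rnorm x ^+ 2).
Proof.
rewrite /conjK /toK /rnorm /ReK; case: k x => //= [x|[a b] /=].
  by rewrite real_normK ?num_real// expr2.
rewrite sqr_sqrtr ?addr_ge0 ?sqr_ge0//; apply/eqP.
by rewrite eq_complex /=; apply/andP; split; apply/eqP; ring.
Qed.

End ScalarTheory.

Section Bessel.
Context (R : realType) (k : scalar_kind).
Local Notation K := (scalars R k).
Variables (H : normedModType K) (dot : {dot H for @conjK R k}).

Lemma dotC x y : dot x y = conjK (dot y x).
Proof.
by have := @hermitian_subproof _ _ _ _ dot x y; rewrite expr0 mul1r.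
Qed.

Hypothesis normH : forall x : H, dot x x = `|x| ^+ 2.

Lemma dot_rnorm x : dot x x = toK (rnorm x ^+ 2).
Proof. by rewrite normH toK_rnorm toKX. Qed.

(** The remainder [y] of [x] after subtraction of its projection is orthogonal to [B], and its
    square norm is the difference of the two sides. *)
Lemma Bessel (B : {fset H}) x :
  (forall f g, f \in B -> g \in B -> dot f g = (f == g)%:R) ->
  \sum_(f <- B) rnorm (dot x f) ^+ 2 <= rnorm x ^+ 2.
Proof.
move=> oB; pose y := x - \sum_(f <- B) dot x f *: f.
have yf f : f \in B -> dot y f = 0.
  move=> fB; rewrite linearBl linear_sumlz (big_fsetD1 f)//=.
  rewrite linearZl_LR /= (oB f f fB fB) eqxx mulr1 big_seq big1 ?addr0 ?subrr// => g.
  by rewrite !inE => /andP[gf gB]; rewrite linearZl_LR /= (oB g f gB fB) (negbTE gf) mulr0.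
have : dot y y = toK (rnorm x ^+ 2 - \sum_(f <- B) rnorm (dot x f) ^+ 2).
  rewrite {2}/y linearBr linear_sumr big_seq big1 ?subr0; last first.
    by move=> f fB; rewrite linearZr_LR /= yf// mulr0.
  transitivity (dot x x - \sum_(f <- B) dot x f * dot f x).
    rewrite /y linearBl linear_sumlz; congr (_ - _).
    by apply: eq_bigr => f _; rewrite linearZl_LR.
  apply/eqP; rewrite dot_rnorm subr_eq.
  rewrite -{1}[rnorm x ^+ 2](subrK (\sum_(f <- B) rnorm (dot x f) ^+ 2)).
  rewrite toKD (inj_eq (addrI _)); apply/eqP; rewrite toK_sum.
  by apply: eq_bigr => f _; rewrite (dotC f x) mulK_conjK.
rewrite dot_rnorm => /toK_inj h; have := sqr_ge0 (rnorm y); rewrite h.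
by rewrite subr_ge0.
Qed.

End Bessel.

(** * The cube as a metric space *)

Section CubeMetric.
Variables (R : realType) (k : scalar_kind).
Local Notation K := (scalars R k).
Local Notation Q := (Q R k).
Implicit Types p q r : Q.

Lemma nbhs_rnorm (V : normedModType K) (x : V) (A : set V) : nbhs x A ->
  exists2 e : R, 0 < e & forall y, rnorm (x - y) < e -> A y.
Proof.
move=> /nbhs_normP[e /= /ReK_gt0[eE e0] eA]; exists (ReK e) => // y xy.
by apply: eA; rewrite /= eE toK_rnorm toK_lt.
Qed.

Lemma piQ_continuous j : continuous (@piQ R k j).
Proof.
move=> q; apply: (@continuous_comp _ _ _ (fun q : Q => q j)
  (set_val : closed_disc R k -> K)).
  exact: (@proj_continuous _ (fun _ : nat => closed_disc R k) j).
exact: initial_continuous.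
Qed.

Lemma rnorm_piQ j q : rnorm (piQ j q) <= 1.
Proof.
have h : `|piQ j q| <= 1 := set_valP (q j).
by rewrite -(@toK_le R k) toK1 -toK_rnorm.
Qed.

(** The weights tend to 0 while the coordinates stay in a disc of diameter 2, so a bound on all
    terms is a condition on finitely many coordinates. This is why the supremum [Qdist] is a
    distance for the product topology. *)
Definition Qterm p q j : R := rnorm (piQ j p - piQ j q) / j.+1%:R.

Definition Qdist p q : R := sup (range (Qterm p q)).

Lemma Qterm_ge0 p q j : 0 <= Qterm p q j.
Proof. by rewrite divr_ge0// rnorm_ge0. Qed.

Lemma Qterm_le p q j : Qterm p q j <= 2 / j.+1%:R.
Proof.
rewrite ler_wpM2r ?invr_ge0//; apply: le_trans (ler_rnormD _ _) _.
by rewrite rnormN -[2]/(1 + 1) lerD// rnorm_piQ.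
Qed.

Lemma Qterm_has_sup p q : has_sup (range (Qterm p q)).
Proof.
split; first by exists (Qterm p q 0%N), 0%N.
exists 2 => _ [j _ <-]; apply: le_trans (Qterm_le p q j) _.
by rewrite ler_pdivrMr// ler_peMr// ler1n.
Qed.

Lemma Qterm_le_Qdist p q j : Qterm p q j <= Qdist p q.
Proof. by apply: ub_le_sup; [case: (Qterm_has_sup p q)|exists j]. Qed.

Lemma Qdist_le p q (e : R) : (forall j, Qterm p q j <= e) -> Qdist p q <= e.
Proof.
move=> h; apply: ge_sup; first by case: (Qterm_has_sup p q).
by move=> _ [j _ <-].
Qed.

Lemma Qdist_ge0 p q : 0 <= Qdist p q.
Proof. exact: le_trans (Qterm_ge0 p q 0) (Qterm_le_Qdist p q 0). Qed.

Lemma Qdistxx p : Qdist p p = 0.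
Proof.
apply/le_anti; rewrite Qdist_ge0 andbT; apply: Qdist_le => j.
by rewrite /Qterm subrr rnorm0 mul0r.
Qed.

Lemma Qdist_sym p q : Qdist p q = Qdist q p.
Proof.
rewrite /Qdist (_ : Qterm p q = Qterm q p)//; apply/funext => j.
by rewrite /Qterm rnorm_distC.
Qed.

Lemma Qdist_triangle p q r : Qdist p r <= Qdist p q + Qdist q r.
Proof.
apply: Qdist_le => j; apply: le_trans _ (lerD (Qterm_le_Qdist p q j) (Qterm_le_Qdist q r j)).
rewrite /Qterm -mulrDl ler_wpM2r ?invr_ge0//.
by apply: le_trans _ (ler_rnormD _ _); rewrite addrA subrK.
Qed.

Lemma Qdist_near p (e : R) : 0 < e -> \forall q \near p, Qdist p q < e.
Proof.
(* For [j >= n] the terms are then at most [2 / (j + 1) < e / 2], and only [n] coordinates remain to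
   be controlled. *)
move=> e0; pose n := (Num.truncn (4 / e)).+1.
have hn : 4 / e < n%:R by exact: truncnS_gt.
have n0 : 0 < n%:R :> R by rewrite ltr0n.
have near1 (j : 'I_n) : \forall q \near p, rnorm (piQ j p - piQ j q) < e / 2.
  have := @piQ_continuous j p => /(cvg_rnormP (F := nbhs p)); apply.
  by rewrite divr_gt0.
apply: filterS (filter_forall _ near1) => q hq.
apply: (@le_lt_trans _ _ (e / 2)); last lra.
apply: Qdist_le => j; have [jn|nj] := ltnP j n.
  have := hq (Ordinal jn); rewrite /= => h; apply: le_trans _ (ltW h).
  by rewrite ler_pdivrMr// ler_peMr ?ler1n// rnorm_ge0.
apply: le_trans (Qterm_le p q j) _.
rewrite ler_pdivrMr//.
have : n%:R <= j.+1%:R :> R by rewrite ler_nat ltnW.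
move: hn; rewrite ltr_pdivrMr// => h1 h2; nra.
Qed.

Lemma open_Qdist (O : set Q) p : open O -> O p ->
  exists2 e : R, 0 < e & forall q, Qdist p q < e -> O q.
Proof.
move=> oO Op.
(* The filter of balls around [p] converges to [p] as soon as each coordinate does, the product
   topology being a supremum of initial topologies. *)
pose F : set_system Q := filter_from [set e : R | 0 < e]
  (fun e => [set q | Qdist p q < e]).
have FF : Filter F.
  apply: filter_from_filter; first by exists 1 => /=.
  move=> i j /= i0 j0; exists (Num.min i j); first by rewrite /= lt_min i0.
  by move=> q /=; rewrite lt_min => /andP[].
have Fp : F --> p.
  apply/cvg_sup => j A /= [_ [[B [C oC <-] <-] Cp sCA]].
  have [e e0 eC] := nbhs_rnorm (open_nbhs_nbhs (conj oC Cp)).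
  (* The division by [j + 1] compensates the weight of the [j]-th term. *)
  exists (e / j.+1%:R); first by rewrite /= divr_gt0.
  move=> q /= pq; apply: sCA => /=; apply: eC.
  have := le_lt_trans (Qterm_le_Qdist p q j) pq.
  by rewrite /Qterm ltr_pM2r ?invr_gt0.
have [e e0 eO] : F O by apply: Fp; exact: open_nbhs_nbhs.
by exists e.
Qed.

Definition Qdist_set (A : set Q) q : R := inf [set Qdist q p | p in A].

Section DistSet.
Variables (A : set Q) (p0 : Q) (Ap0 : A p0).

Let has_inf_dist q : has_inf [set Qdist q p | p in A].
Proof.
split; first by exists (Qdist q p0), p0.
by exists 0 => _ [p _ <-]; exact: Qdist_ge0.
Qed.

Lemma Qdist_set_le q p : A p -> Qdist_set A q <= Qdist q p.
Proof. by move=> Ap; apply: ge_inf; [case: (has_inf_dist q)|exists p]. Qed.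

Lemma Qdist_set_ge q (e : R) : (forall p, A p -> e <= Qdist q p) ->
  e <= Qdist_set A q.
Proof.
by move=> h; apply: lb_le_inf => [|_ [p Ap <-]]; [case: (has_inf_dist q)|exact: h].
Qed.

Lemma Qdist_set_ge0 q : 0 <= Qdist_set A q.
Proof. by apply: Qdist_set_ge => p _; exact: Qdist_ge0. Qed.

Lemma Qdist_set_lip q r : Qdist_set A q <= Qdist q r + Qdist_set A r.
Proof.
rewrite -lerBlDl; apply: Qdist_set_ge => p Ap; rewrite lerBlDl.
exact: le_trans (Qdist_set_le _ Ap) (Qdist_triangle _ _ _).
Qed.

Lemma Qdist_set_continuous : continuous (Qdist_set A).
Proof.
move=> q; apply/(@cvgrPdist_lt _ _ _ (nbhs q)) => e e0.
apply: filterS (Qdist_near q e0) => r; apply: le_lt_trans.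
rewrite ler_norml lerBrDl; apply/andP; split.
  by have := Qdist_set_lip r q; rewrite Qdist_sym; lra.
by have := Qdist_set_lip q r; lra.
Qed.

End DistSet.

(** The test functions of the whole argument; the bound is carried along in place of an appeal to
    compactness of [Q]. *)
Definition bcont (h : Q -> R) : Prop :=
  continuous h /\ exists M : R, forall q, `|h q| <= M.

Lemma bcont_cst (c : R) : bcont (fun=> c).
Proof. by split; [exact: cst_continuous|exists `|c|]. Qed.

Lemma bcontZD (a : R) f g : bcont f -> bcont g -> bcont (fun q => a * f q + g q).
Proof.
move=> [cf [M fM]] [cg [N gN]]; split.
  move=> q; apply: (@cvgD _ _ _ (nbhs q)); last exact: cg.
  by apply: (@cvgM _ _ (nbhs q)); [exact: cvg_cst|exact: cf].
exists (`|a| * M + N) => q; apply: le_trans (ler_normD _ _) _.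
by rewrite lerD// normrM ler_wpM2l.
Qed.

Lemma bcontM f g : bcont f -> bcont g -> bcont (fun q => f q * g q).
Proof.
move=> [cf [M fM]] [cg [N gN]]; split.
  by move=> q; apply: (@cvgM _ _ (nbhs q)); [exact: cf|exact: cg].
by exists (M * N) => q; rewrite normrM ler_pM.
Qed.

Lemma bcont_piQ (a : K) j : bcont (fun q => ReK (a * piQ j q)).
Proof.
split.
  move=> q; apply: (@cvg_ReK _ _ _ (nbhs q)).
  by apply: (@cvgM _ _ (nbhs q)); [exact: cvg_cst|exact: piQ_continuous].
exists (rnorm a) => q; apply: le_trans (normr_ReK _) _.
by rewrite rnormM ler_piMr ?rnorm_ge0// rnorm_piQ.
Qed.

(** Take the minimum of 1 and [n] times the distance to the complement of [A]. *)
Lemma open_bcont_approx (A : set Q) : open A ->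
  exists h : nat -> Q -> R, [/\ forall n, bcont (h n),
    forall n q, `|h n q| <= 1 &
    forall q, h n q @[n --> \oo] --> (\1_A q : R)].
Proof.
(* With an empty complement the infimum defining the distance is a default value, hence the separate
   case. *)
move=> oO; have [C0|/set0P[p0 Op0]] := eqVneq (~` A) set0.
  exists (fun _ _ => 1); split=> [n|n q|q]; first exact: bcont_cst.
    by rewrite normr1.
  by rewrite (_ : A = setT) ?indicT; [exact: cvg_cst|rewrite -setC0 -C0 setCK].
pose h (n : nat) q := Num.min 1 (n%:R * Qdist_set (~` A) q).
have h01 n q : 0 <= h n q <= 1.
  by rewrite /h le_min ler01 ge_min lexx mulr_ge0 ?(Qdist_set_ge0 Op0).
have hb n q : `|h n q| <= 1 by have /andP[h0 h1] := h01 n q; rewrite ger0_norm.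
exists h; split=> //.
  move=> n; split; last by exists 1.
  move=> q; apply: (@continuous_min _ _ (cst 1) (fun q => n%:R * Qdist_set (~` A) q)).
    exact: cst_continuous.
  by apply: (@cvgM _ _ (nbhs q)); [exact: cvg_cst|exact: (Qdist_set_continuous Op0)].
move=> q; rewrite indicE; have [qO|qO] := boolP (q \in A).
  have [e e0 eO] := open_Qdist oO (set_mem qO).
  have de : e <= Qdist_set (~` A) q.
    by apply: (Qdist_set_ge Op0) => p /= Op; rewrite leNgt; apply/negP => /eO.
  (* Once [n > 1 / e], with [e] a lower bound of the distance from [q] to the complement, the
     minimum is 1. *)
  apply: cvg_near_cst; exists (Num.truncn e^-1).+1 => // n /= hn.
  rewrite /h min_l// -(ler_pdivrMr _ _ (lt_le_trans e0 de)) mul1r.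
  have : e^-1 < n%:R.
    by apply: lt_le_trans (truncnS_gt _) _; rewrite ler_nat.
  move=> /ltW; apply: le_trans.
  by rewrite lef_pV2 ?posrE// (lt_le_trans e0).
have -> : (false%:R : R) = 0 by [].
suff hn n : h n q = 0 by under eq_fun do rewrite hn; exact: cvg_cst.
rewrite /h (_ : Qdist_set _ q = 0) ?mulr0 ?min_r//; apply/le_anti.
rewrite (Qdist_set_ge0 Op0) andbT -(Qdistxx q); apply: (Qdist_set_le Op0).
by move=> /= /mem_set; apply/negP.
Qed.

Lemma continuous_measurable_borelQ (h : Q -> R) : continuous h ->
  measurable_fun [set: borelQ R k] h.
Proof.
move=> /continuousP ch; apply: (measurability _ (RGenOpens.measurableE R)).
move=> _ [_ [a [b ->] <-]]; rewrite setTI; apply: sub_sigma_algebra.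
exact/ch/interval_open.
Qed.

Lemma bcont_measurable (h : Q -> R) : bcont h -> measurable_fun [set: borelQ R k] h.
Proof. by move=> [/continuous_measurable_borelQ]. Qed.

Variable mu : probability (borelQ R k) R.

Lemma bcont_sqint (h : Q -> R) : bcont h -> sqint mu h.
Proof.
by move=> bh; have [_ [M hM]] := bh; apply: (@bounded_sqint _ _ _ mu M) => //;
  exact: bcont_measurable.
Qed.

(** * Integrable functions orthogonal to all bounded continuous functions *)

Section Vanish.
Variable g : borelQ R k -> R.
Hypothesis ig : mu.-integrable setT (EFin \o g).
Hypothesis g0 : forall h, bcont h -> \int[mu]_q (g q * h q) = 0.

Let mg : measurable_fun setT g.
Proof. by apply/measurable_EFinP; exact: (measurable_int mu ig). Qed.

(** Dominated convergence along test functions that tend to the indicator of [A], dominated by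
    [|g|]. *)
Let vanish_open (A : set Q) : open A -> (\int[mu]_(q in A) (g q)%:E = 0)%E.
Proof.
move=> oA; have mA : measurable (A : set (borelQ R k)).
  exact: sub_sigma_algebra.
have [h [bh h1 hA]] := open_bcont_approx oA.
rewrite integral_mkcond.
have [] := @dominated_convergence _ _ _ mu setT measurableT
  (fun n q => (g q * h n q)%:E) ((EFin \o g) \_ A) (abse \o (EFin \o g)).
- move=> n; apply/measurable_EFinP; apply: measurable_funM => //.
  exact: bcont_measurable.
- by apply/(measurable_restrictT _ mA)/measurable_funTS/measurable_EFinP.
- apply: aeW => q _; rewrite (_ : _ q = (g q * \1_A q)%:E); last first.
    by rewrite patchE indicE; case: ifPn; rewrite ?mulr1 ?mulr0.
  apply: cvg_EFin; first exact: nearW.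
  by apply: cvgM; [exact: cvg_cst|exact: hA].
- exact: integrable_abse.
- apply: aeW => q n _ /=; rewrite lee_fin normrM ler_piMr//.
move=> _ _; have -> : (fun n => \int[mu]_q (g q * h n q)%:E)%E = fun=> 0%E.
  apply/funext => n; have := g0 (bh n); rewrite /Rintegral => h0.
  rewrite -[LHS]fineK ?h0//; apply: integrable_fin_num => //.
  apply: (le_integrable measurableT _ _ ig).
    apply/measurable_EFinP/measurable_funM => //; exact: bcont_measurable.
  by move=> q _ /=; rewrite lee_fin normrM ler_piMr.
by move=> /cvg_lim <-//; rewrite lim_cst.
Qed.

(** Open sets are stable under intersection and generate the Borel sets, so the Dynkin argument
    extends the vanishing of the integrals to all Borel sets. *)
Lemma bcont_vanish_ae : \forall q \ae mu, g q = 0.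
Proof.
have H : forall S, measurable S -> (\int[mu]_(q in S) (g q)%:E = 0)%E.
  apply: (@dynkin_induction _ (borelQ R k) (@open Q)
    (fun S => \int[mu]_(q in S) (g q)%:E = 0)%E) => //.
  - by move=> B C; exact: openI.
  - by apply: vanish_open; exact: openT.
  - move=> B mB B0; have := vanish_open openT.
    rewrite -(setUv B) integral_setU_EFin//;
      [|exact: measurableC|exact: measurable_funTS|].
      by rewrite B0 add0e.
    by apply/disj_setPS => x [].
  - move=> F mF tF F0; rewrite integral_bigcup//; last first.
      by apply: (integrableS measurableT _ _ ig) => //; exact: bigcup_measurable.
    by rewrite eseries0// => i _ _; exact: F0.
have := @integral_ae_eq _ _ _ mu setT measurableT (cst 0%E) _ ig.
case=> //.
  by move=> E _ mE; rewrite integral0; exact: H.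
move=> N [mN N0 sN]; exists N; split=> //.
by move=> q gq; apply: sN => /= /(_ I) [] /gq.
Qed.

End Vanish.

End CubeMetric.

(** * Functionals converging on a dense span *)

Lemma normr_le_of_sqr (R : rcfType) (C r z : R) : 0 <= C -> 0 <= r ->
  z ^+ 2 <= C * r ^+ 2 -> `|z| <= Num.sqrt C * r.
Proof.
move=> C0 r0 h; rewrite -(ger0_norm r0) -!sqrtr_sqr -sqrtrM//.
exact: ler_wsqrtr.
Qed.

Lemma cvg_finer (T : topologicalType) (F G : set_system nat) (u : nat -> T) (l : T) :
  F `<=` G -> u n @[n --> F] --> l -> u n @[n --> G] --> l.
Proof. by move=> FG ul A /ul; exact: FG. Qed.

Section DenseConvergence.
Context (R : realType) (k : scalar_kind).
Local Notation K := (scalars R k).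
Variables (H : normedModType K) (Hn : nat -> set H).
Hypothesis Hn_lin : forall n, lin_subspace (Hn n).
Variables (F : set_system nat) (FF : ProperFilter F) (F_oo : \oo `<=` F).
Variables (Psi : nat -> H -> R) (Phi : H -> R) (B : R) (E : set H).
Hypothesis B0 : 0 <= B.
Hypothesis PsiD : forall n x y, Psi n (x + y) = Psi n x + Psi n y.
Hypothesis Psi_le : forall n x, Hn n x -> `|Psi n x| <= B * rnorm x.
Hypothesis PhiD : forall x y, Phi (x + y) = Phi x + Phi y.
Hypothesis Phi_le : forall x, `|Phi x| <= B * rnorm x.
Hypothesis E_dense : dense (lin_span E).
Hypothesis E_cvg : forall x, E x -> exists x_ : nat -> H,
  [/\ forall n, Hn n (x_ n), x_ n @[n --> \oo] --> x &
    forall a : K, Psi n (a *: x_ n) @[n --> F] --> Phi (a *: x)].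

(** The good vectors form a subspace containing [E]. Convergence is carried for all multiples [a]
    because [Psi n] and [Phi] are only additive: in the application they involve real parts, which
    do not commute with complex scalars. *)
Let span_cvg x : lin_span E x -> exists x_ : nat -> H,
  [/\ forall n, Hn n (x_ n), x_ n @[n --> \oo] --> x &
    forall a : K, Psi n (a *: x_ n) @[n --> F] --> Phi (a *: x)].
Proof.
pose P := [set x | exists x_ : nat -> H,
  [/\ forall n, Hn n (x_ n), x_ n @[n --> \oo] --> x &
    forall a : K, Psi n (a *: x_ n) @[n --> F] --> Phi (a *: x)]].
move=> sx; apply: (sx P); split => //; split.
  exists (fun=> 0); split; [by move=> n; case: (Hn_lin n)|exact: cvg_cst|].
  move=> a; rewrite scaler0.
  have Phi0 : Phi 0 = 0 by have := PhiD 0 0; rewrite addr0; lra.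
  have Psi0 n : Psi n 0 = 0 by have := PsiD n 0 0; rewrite addr0; lra.
  by under eq_fun do rewrite Psi0; rewrite Phi0; exact: cvg_cst.
move=> b y z [y_ [Hy cy Py]] [z_ [Hz cz Pz]].
exists (fun n => b *: y_ n + z_ n); split.
- by move=> n; apply: (Hn_lin n).2.
- by apply: cvgD => //; exact: cvgZr.
move=> a; rewrite scalerDr scalerA PhiD.
under eq_fun do rewrite scalerDr scalerA PsiD.
by apply: cvgD; [exact: Py|exact: Pz].
Qed.

(** Approximate [x] by [y] in the span: the error splits into [Phi (x - y)], the error at [y], and
    [Psi n (y_ n - x_ n)], the outer two being small by the common bound [B]. *)
Lemma dense_convergence (x_ : nat -> H) x : (forall n, Hn n (x_ n)) ->
  x_ n @[n --> \oo] --> x -> Psi n (x_ n) @[n --> F] --> Phi x.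
Proof.
move=> Hx xx; apply/cvgrPdist_lt => e e0.
(* Chosen so that [B * d < e / 4]; the added 1 covers the case [B = 0]. *)
pose d : R := e / (4 * (B + 1)).
have B1 : 0 < 4 * (B + 1) by rewrite mulr_gt0// ltr_wpDl.
have d0 : 0 < d by rewrite divr_gt0.
have dE : d * (4 * (B + 1)) = e by rewrite divfK ?gt_eqF.
clearbody d; have Bd : 4 * (B * d) < e.
  rewrite -dE mulrDr mulr1 mulrDr (mulrC d) -mulrA (mulrC d) ltrDl.
  by rewrite mulr_gt0.
have [y [/= xy sy]] : [set y | rnorm (x - y) < d] `&` lin_span E !=set0.
  apply: E_dense; first by exists x; rewrite /= subrr rnorm0.
  rewrite openE => y /= xy; apply: (@cvgr_lt _ _ (nbhs y) _ _ (rnorm (x - y))) => //.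
  apply: (@continuous_comp _ _ _ (fun y : H => x - y) (@rnorm R k H)).
    by apply: (@cvgB _ _ _ (nbhs y)); [exact: cvg_cst|exact: cvg_id].
  exact: rnorm_continuous.
have [y_ [Hy yy Py]] := span_cvg sy.
have P2 : \forall n \near F, rnorm (x_ n - y_ n) < d.
  apply: F_oo; apply: (@cvgr_lt _ _ \oo _ _ (rnorm (x - y))) => //.
  apply: (cvg_comp (fun n => x_ n - y_ n) (@rnorm R k H) (G := nbhs (x - y))).
    exact: cvgB.
  exact: rnorm_continuous.
have e4 : 0 < e / 4 by rewrite divr_gt0.
have := Py 1; rewrite scale1r => /cvgrPdist_lt/(_ _ e4) P3.
apply: filterS2 P2 P3 => n h2; rewrite scale1r => h3.
have -> : Phi x - Psi n (x_ n) =
    Phi (x - y) + (Phi y - Psi n (y_ n)) + Psi n (y_ n - x_ n).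
  have h1 := PhiD (x - y) y; rewrite subrK in h1.
  have h4 := PsiD n (y_ n - x_ n) (x_ n); rewrite subrK in h4.
  lra.
(* [Psi n] is bounded on [Hn n] only, so the difference has to stay in that subspace. *)
have Hyx : Hn n (y_ n - x_ n).
  by rewrite addrC -scaleN1r; apply: (Hn_lin n).2.
have b1 := Phi_le (x - y); have b2 := Psi_le Hyx.
rewrite rnorm_distC in b2.
have b3 : B * rnorm (x - y) <= B * d by rewrite ler_wpM2l// ltW.
have b4 : B * rnorm (x_ n - y_ n) <= B * d by rewrite ler_wpM2l// ltW.
have := ler_normD (Phi (x - y) + (Phi y - Psi n (y_ n))) (Psi n (y_ n - x_ n)).
have := ler_normD (Phi (x - y)) (Phi y - Psi n (y_ n)).
lra.
Qed.

End DenseConvergence.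

(** * Sums over the eigenbases *)

Section SamplingSums.
Context (R : realType) (k : scalar_kind).
Local Notation K := (scalars R k).
Variables (H : completeNormedModType K) (dot : {dot H for @conjK R k}).
Hypothesis normH : forall x : H, dot x x = `|x| ^+ 2.
Variables (D : set H) (A : H -> H) (S : sampling_scale_sequence dot D A).

(** Integration against [mu_n] for real functions, the counterpart of [integral_Omega]. *)
Definition rsum (n : nat) (g : H -> R) : R :=
  \sum_(f <- ss_Omega S n) mass S n f * g f.

Lemma mass_ge0 n f : 0 <= mass S n f.
Proof.
apply: sumr_ge0 => j _; rewrite mulr_ge0 ?sqr_ge0// ltW//.
exact: (scale_c_gt0 (ss_scale S)).
Qed.

Lemma mass_gt0 n f : f \in ss_Omega S n -> 0 < mass S n f.
Proof.
move=> fO; have [j jN ejf] := ss_nondegenerate fO.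
have c0 i : (i < ss_N S n)%N -> 0 < ss_c S n i.
  exact: (scale_c_gt0 (ss_scale S)).
rewrite /mass (bigD1 (Ordinal jN))//= ltr_pwDl//; last first.
  by apply: sumr_ge0 => i _; rewrite mulr_ge0 ?sqr_ge0// ltW// c0.
rewrite mulr_gt0 ?c0// exprn_gt0// lt0r rnorm_ge0 andbT.
apply: contra ejf => /eqP e0; rewrite -normr_eq0 toK_rnorm e0.
by rewrite toK0.
Qed.

Lemma eq_rsum n g h : (forall f, f \in ss_Omega S n -> g f = h f) ->
  rsum n g = rsum n h.
Proof. by move=> gh; apply: eq_big_seq => f /gh ->. Qed.

Lemma rsumZD n a g h :
  rsum n (fun f => a * g f + h f) = a * rsum n g + rsum n h.
Proof.
rewrite /rsum mulr_sumr -big_split/=; apply: eq_bigr => f _; ring.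
Qed.

Lemma rsumZ n a g : rsum n (fun f => a * g f) = a * rsum n g.
Proof. by rewrite /rsum mulr_sumr; apply: eq_bigr => f _; ring. Qed.

Lemma rsumD n g h : rsum n (fun f => g f + h f) = rsum n g + rsum n h.
Proof. by rewrite /rsum -big_split/=; apply: eq_bigr => f _; ring. Qed.

Lemma ler_rsum n g h : (forall f, f \in ss_Omega S n -> g f <= h f) ->
  rsum n g <= rsum n h.
Proof.
move=> gh; rewrite /rsum big_seq [leRHS]big_seq; apply: ler_sum => f fO.
by rewrite ler_wpM2l ?mass_ge0// gh.
Qed.

Lemma rsum_sqr_ge0 n g : 0 <= rsum n (fun f => g f ^+ 2).
Proof. by apply: sumr_ge0 => f _; rewrite mulr_ge0 ?mass_ge0 ?sqr_ge0. Qed.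

Lemma Cauchy_Schwarz_rsum n g h : rsum n (fun f => g f * h f) ^+ 2 <=
  rsum n (fun f => g f ^+ 2) * rsum n (fun f => h f ^+ 2).
Proof.
apply: sqr_le_of_quadratic_ge0 => [|t]; first exact: rsum_sqr_ge0.
suff -> : rsum n (fun f => g f ^+ 2) * t ^+ 2 +
    2 * rsum n (fun f => g f * h f) * t + rsum n (fun f => h f ^+ 2) =
    rsum n (fun f => (t * g f + h f) ^+ 2) by exact: rsum_sqr_ge0.
have -> : rsum n (fun f => (t * g f + h f) ^+ 2) = rsum n (fun f =>
    t ^+ 2 * g f ^+ 2 + (2 * t * (g f * h f) + h f ^+ 2)).
  by apply: eq_rsum => f _; ring.
rewrite !rsumZD; ring.
Qed.

Lemma rsum_sqrM_le n (M : R) g h : 0 <= M -> (forall f, `|h f| <= M) ->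
  rsum n (fun f => (g f * h f) ^+ 2) <= M ^+ 2 * rsum n (fun f => g f ^+ 2).
Proof.
move=> M0 hM; rewrite -rsumZ; apply: ler_rsum => f _.
rewrite exprMn mulrC ler_wpM2r ?sqr_ge0// -real_normK ?num_real//.
by rewrite lerXn2r ?nnegrE.
Qed.

(** Expanding the mass and exchanging the sums leaves, for each [j], the Bessel sum of [y j]. Taking
    [y j] to be [e n j] or its image under [A_n], with [l] equal to 1 or to the eigenvalue, bounds
    the total mass or the second moment of the eigenvalues. *)
Lemma rsum_rnorm_dot n (l : H -> R) (y : nat -> H) :
  (forall f j, f \in ss_Omega S n -> (j < ss_N S n)%N ->
    rnorm (dot (y j) f) = `|l f| * rnorm (dot (ss_e S n j) f)) ->
  rsum n (fun f => l f ^+ 2) <= \sum_(j < ss_N S n) ss_c S n j * rnorm (y j) ^+ 2.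
Proof.
move=> yl; rewrite /rsum big_seq.
under eq_bigr => f fO.
  rewrite /mass mulr_suml.
  under eq_bigr => j _.
    rewrite -(real_normK (num_real (l f))) -mulrA -exprMn [_ * `|l f|]mulrC.
    rewrite -(yl f j fO (ltn_ord j)); over.
  over.
rewrite -big_seq exchange_big/=; apply: ler_sum => j _; rewrite -mulr_sumr.
rewrite ler_wpM2l//; first exact/ltW/(scale_c_gt0 (ss_scale S)).
apply: Bessel => // f g.
exact: (eigenbasis_orthonormal (sampling_eigenbasis (ss_sampling S) n)).
Qed.

(** The square keeps the shape in which [rsum_sqrM_le] produces this sum. *)
Lemma rsum1_le1 n : rsum n (fun=> 1 ^+ 2) <= 1.
Proof.
apply: le_trans (rsum_rnorm_dot (l := fun=> 1) (y := ss_e S n) _) _.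
  by move=> f j _ _; rewrite normr1 mul1r.
by rewrite (scale_sum (ss_scale S)).
Qed.

Lemma Omega_sub n f : f \in ss_Omega S n -> ss_H S n f.
Proof.
move=> fO; have := sampling_eigenbasis (ss_sampling S) n.
by move=> /eigenbasis_span <-; exact: sub_gen_smallest.
Qed.

(** Symmetry equates the eigenvalue with its conjugate, as [f] is a unit vector. *)
Lemma eigenvalue_real n f : f \in ss_Omega S n ->
  exists l : R, ss_A S n f = toK l *: f.
Proof.
move=> fO; have sB := sampling_eigenbasis (ss_sampling S) n.
have [l lf] := eigenbasis_eigen sB fO.
have ff : dot f f = 1 by rewrite (eigenbasis_orthonormal sB)// eqxx.
have := sampling_symmetric (ss_sampling S) (Omega_sub fO) (Omega_sub fO).
rewrite lf linearZl_LR linearZr_LR /= ff !mulr1 => /esym/conjK_real lE.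
by exists (ReK l); rewrite -lE.
Qed.

(** Meaningful for [f] in [Omega_n]; elsewhere [get] may return a default value. *)
Definition eigenval n f : R := get [set l : R | ss_A S n f = toK l *: f].

Lemma eigenvalP n f : f \in ss_Omega S n ->
  ss_A S n f = toK (eigenval n f) *: f.
Proof.
by move=> /eigenvalue_real[l hl]; apply: (getI (P := [set l : R | _ = toK l *: f])) hl.
Qed.

Lemma dot_eigenval n x f : ss_H S n x -> f \in ss_Omega S n ->
  dot (ss_A S n x) f = toK (eigenval n f) * dot x f.
Proof.
move=> Hx fO; rewrite (sampling_symmetric (ss_sampling S) Hx (Omega_sub fO)).
by rewrite eigenvalP// linearZr_LR /= conjK_toK.
Qed.

(** The coefficient of [A_n (e n j)] along [f] is the eigenvalue times that of [e n j], so
    [ss_bounded] controls the eigenvalues in the L2 norm of [mu_n], uniformly in [n]. *)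
Lemma rsum_eigenval_bounded : exists2 C : R, 0 <= C &
  forall n, rsum n (fun f => eigenval n f ^+ 2) <= C.
Proof.
have [C hC] := ss_bounded S.
have h n : rsum n (fun f => eigenval n f ^+ 2) <= C.
  apply: le_trans _ (ltW (hC n)).
  apply: (rsum_rnorm_dot (y := fun j => ss_A S n (ss_e S n j))) => f j fO jN.
  by rewrite dot_eigenval ?rnormM ?rnorm_toK//; exact: (ss_e_in jN).
by exists C => //; exact: le_trans (rsum_sqr_ge0 _ _) (h 0%N).
Qed.

Lemma U_nZD n a x y f : U_n S n (a *: x + y) f = a * U_n S n x f + U_n S n y f.
Proof. by rewrite /U_n linearPl /= mulrDl mulrA. Qed.

Lemma U_nD n x y f : U_n S n (x + y) f = U_n S n x f + U_n S n y f.
Proof. by rewrite -{1}[x]scale1r U_nZD mul1r. Qed.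

Lemma U_nZ n a x f : U_n S n (a *: x) f = a * U_n S n x f.
Proof. by rewrite /U_n linearZl_LR /= mulrA. Qed.

Lemma U_n_eigenval n x f : ss_H S n x -> f \in ss_Omega S n ->
  U_n S n (ss_A S n x) f = toK (eigenval n f) * U_n S n x f.
Proof. by move=> Hx fO; rewrite /U_n dot_eigenval// mulrA. Qed.

(** Dividing by the square root of the mass cancels the weight, which leaves a Bessel sum. *)
Lemma rsum_U_n n x : rsum n (fun f => rnorm (U_n S n x f) ^+ 2) <= rnorm x ^+ 2.
Proof.
apply: le_trans _ (Bessel normH x
  (@eigenbasis_orthonormal _ _ _ _ _ _ (sampling_eigenbasis (ss_sampling S) n))).
rewrite /rsum big_seq [leRHS]big_seq; apply: ler_sum => f fO.
have m0 := mass_gt0 fO.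
rewrite /U_n rnormM -toKV rnorm_toK ger0_norm ?invr_ge0 ?sqrtr_ge0//.
rewrite exprMn exprVn sqr_sqrtr ?mass_ge0// mulrC -mulrA mulVf ?mulr1//.
by rewrite gt_eqF.
Qed.

Lemma rsum_ReU_n n (C : R) (g : H -> R) x : 0 <= C ->
  rsum n (fun f => g f ^+ 2) <= C ->
  `|rsum n (fun f => g f * ReK (U_n S n x f))| <= Num.sqrt C * rnorm x.
Proof.
move=> C0 gC; apply: normr_le_of_sqr => //; first exact: rnorm_ge0.
apply: le_trans (Cauchy_Schwarz_rsum _ _ _) _.
apply: ler_pM => //; [exact: rsum_sqr_ge0|exact: rsum_sqr_ge0|].
apply: le_trans _ (rsum_U_n n x); apply: ler_rsum => f _.
rewrite -real_normK ?num_real//.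
by rewrite lerXn2r ?nnegrE ?rnorm_ge0// normr_ReK.
Qed.

Lemma piQ_X_n n f j : (j < ss_N S n)%N ->
  piQ j (X_n S n f) = toK (Num.sqrt (ss_c S n j)) * U_n S n (ss_e S n j) f.
Proof. by move=> jN; rewrite /piQ /X_n set_valE /= /coord_X jN. Qed.

Lemma integral_Omega_toK n (g : H -> R) :
  integral_Omega S n (fun f => toK (g f)) = toK (rsum n g).
Proof. by rewrite /rsum toK_sum; apply: eq_bigr => f _; rewrite toKM. Qed.

Hypothesis S_convergent : convergent S.
Variable mu : probability (borelQ R k) R.
Hypothesis mu_associated : associated_measure S mu.

Lemma Kintegral_toK (h : borelQ R k -> R) :
  Kintegral mu (fun q => toK (h q) : K) = toK (\int[mu]_q h q).
Proof.
rewrite /Kintegral /toK; case: k mu h => //= mu' h.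
by rewrite Rintegral_cst_setT.
Qed.

(** Convergence of [S] makes the limit in [associated_measure] a genuine one; real test functions
    are embedded in [K] and recovered by real parts. *)
Lemma rsum_cvg (h : Q R k -> R) : bcont h ->
  rsum n (h \o X_n S n) @[n --> \oo] --> \int[mu]_q h q.
Proof.
move=> [ch _].
have ck : continuous (fun q => toK (h q) : K).
  by move=> q; apply: (@cvg_toK _ _ _ (nbhs q)); exact: ch.
have := S_convergent ck; rewrite -(mu_associated ck) Kintegral_toK.
move=> /cvg_ReK; rewrite toKK; apply: cvg_trans; apply: near_eq_cvg.
by apply: nearW => n; rewrite -[RHS](@toKK R k) -integral_Omega_toK.
Qed.

End SamplingSums.

(** * Weak-strong convergence *)

Section BorelScalars.
Context (R : realType) (k : scalar_kind).
Local Notation K := (scalars R k).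

Lemma continuous_measurable_borelK (h : K -> R) : continuous h ->
  measurable_fun [set: borelK R k] h.
Proof.
move=> /continuousP ch; apply: (measurability _ (RGenOpens.measurableE R)).
move=> _ [_ [a [b ->] <-]]; rewrite setTI; apply: sub_sigma_algebra.
exact/ch/interval_open.
Qed.

Lemma toK_measurable : measurable_fun [set: R] (@toK R k : R -> borelK R k).
Proof.
apply: (@measurability _ _ _ (borelK R k) _ _ (@open K)) => //.
move=> _ [B oB <-]; rewrite setTI; apply: open_measurable.
by move/continuousP: (@toK_continuous R k); exact.
Qed.

Variable mu : probability (borelQ R k) R.

Lemma mfun_measurable (f : {mfun_ mu, borelQ R k >-> borelK R k}) :
  measurable_fun setT (f : borelQ R k -> borelK R k).
Proof. exact: measurable_funPT. Qed.

Lemma mfun_comp_measurable (h : K -> R)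
    (f : {mfun_ mu, borelQ R k >-> borelK R k}) : continuous h ->
  measurable_fun setT (fun q => h (f q)).
Proof.
move=> ch; apply: (@measurableT_comp _ _ _ _ (borelK R k)).
  exact: continuous_measurable_borelK.
exact: mfun_measurable.
Qed.

Lemma ae_eq_Rintegral (f g : borelQ R k -> R) :
  measurable_fun setT f -> measurable_fun setT g ->
  (\forall q \ae mu, f q = g q) -> \int[mu]_q f q = \int[mu]_q g q.
Proof.
move=> mf mg fg; congr fine; apply: ae_eq_integral => //.
- exact/measurable_EFinP.
- exact/measurable_EFinP.
by apply: filterS fg => q ->.
Qed.

End BorelScalars.

Section WeakStrong.
Context (R : realType) (k : scalar_kind).
Local Notation K := (scalars R k).
Variables (H : completeNormedModType K) (dot : {dot H for @conjK R k}).
Hypothesis normH : forall x : H, dot x x = `|x| ^+ 2.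
Variables (D : set H) (A : H -> H) (S : sampling_scale_sequence dot D A).
Variable mu : probability (borelQ R k) R.
Variable Uhat : H -> {mfun_ mu, borelQ R k >-> borelK R k}.
Hypothesis UhatP : associated_isometry S Uhat.

Local Notation ReU x := (fun q => ReK (Uhat x q : K)).

Lemma ReUhat_measurable x : measurable_fun setT (ReU x).
Proof. exact: (mfun_comp_measurable _ (@ReK_continuous R k)). Qed.

Lemma rnormUhat_measurable x : measurable_fun setT (fun q => rnorm (Uhat x q : K)).
Proof. exact: (mfun_comp_measurable _ (@rnorm_continuous R k K)). Qed.

Lemma sqint_rnormUhat x : sqint mu (fun q => rnorm (Uhat x q : K)).
Proof.
apply: sqintE; first exact: rnormUhat_measurable.
by rewrite (isometry_norm UhatP) ltry.
Qed.

Lemma Rintegral_rnormUhat x :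
  \int[mu]_q (rnorm (Uhat x q : K) ^+ 2) = rnorm x ^+ 2.
Proof. by rewrite /Rintegral (isometry_norm UhatP). Qed.

Lemma sqint_ReUhat x : sqint mu (ReU x).
Proof.
split; first exact: ReUhat_measurable.
apply: (le_integrable measurableT _ _ (sqint_rnormUhat x).2).
  by apply/measurable_EFinP/measurable_funX; exact: ReUhat_measurable.
move=> q _ /=; rewrite lee_fin !ger0_norm ?sqr_ge0// -real_normK ?num_real//.
by rewrite lerXn2r ?nnegrE ?rnorm_ge0// normr_ReK.
Qed.

Lemma Rintegral_ReUhat_le x : \int[mu]_q (ReU x q ^+ 2) <= rnorm x ^+ 2.
Proof.
rewrite -Rintegral_rnormUhat; apply: le_Rintegral => //.
- exact: (sqint_ReUhat x).2.
- exact: (sqint_rnormUhat x).2.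
move=> q _; rewrite -real_normK ?num_real//.
by rewrite lerXn2r ?nnegrE ?rnorm_ge0// normr_ReK.
Qed.

Lemma UhatD x y :
  \forall q \ae mu, Uhat (x + y) q = (Uhat x q : K) + Uhat y q.
Proof.
by have := isometry_linear UhatP 1 x y; rewrite scale1r; apply: filterS => q; rewrite mul1r.
Qed.

Lemma Uhat0 : \forall q \ae mu, Uhat 0 q = 0 :> K.
Proof.
have := UhatD 0 0; rewrite addr0; apply: filterS => q h.
by apply: (addrI (Uhat 0 q : K)); rewrite -h addr0.
Qed.

Lemma UhatZ a x : \forall q \ae mu, Uhat (a *: x) q = a * (Uhat x q : K).
Proof.
have := isometry_linear UhatP a x 0; rewrite addr0 => h.
by apply: filterS2 h Uhat0 => q -> ->; rewrite addr0.
Qed.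

Section Weak.
Variables (F : set_system nat) (FF : ProperFilter F) (F_oo : \oo `<=` F).
Variables (G : nat -> H -> R) (g : Q R k -> R) (C : R).
Hypothesis C0 : 0 <= C.
Hypothesis G_le : forall n, rsum S n (fun f => G n f ^+ 2) <= C.
Hypothesis g_sq : sqint mu g.
Hypothesis G_weak : forall h, bcont h ->
  rsum S n (fun f => G n f * h (X_n S n f)) @[n --> F] --> \int[mu]_q (g q * h q).

Let Psi n x := rsum S n (fun f => G n f * ReK (U_n S n x f)).
Let Phi x := \int[mu]_q (g q * ReU x q).

Let PhiD x y : Phi (x + y) = Phi x + Phi y.
Proof.
rewrite /Phi -RintegralD//; try exact: (sqintM g_sq (sqint_ReUhat _)).
apply: ae_eq_Rintegral.
- exact: (measurable_funM g_sq.1 (ReUhat_measurable _)).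
- by apply: measurable_funD; exact: (measurable_funM g_sq.1 (ReUhat_measurable _)).
by apply: filterS (UhatD x y) => q ->; rewrite ReKD mulrDr.
Qed.

(** [Uhat] sends the limit vector to [pi_j] divided by the root of [c_j], so the pairing becomes an
    integral against a test function. *)
Let PhiZ_lim_e (a : K) j : Phi (a *: lim_e (ss_e S) j) =
  (Num.sqrt (lim_c (ss_c S) j))^-1 * \int[mu]_q (g q * ReK (a * piQ j q)).
Proof.
have bp := bcont_piQ a j.
rewrite /Phi -RintegralZl//; last exact: (sqintM g_sq (bcont_sqint mu bp)).
apply: ae_eq_Rintegral.
- exact: (measurable_funM g_sq.1 (ReUhat_measurable _)).
- by apply: measurable_funM => //; apply: (measurable_funM g_sq.1); exact: bcont_measurable.
apply: filterS2 (UhatZ a (lim_e (ss_e S) j)) (isometry_V UhatP j) => q -> ->.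
by rewrite mulrCA -toKV ReK_toKM; ring.
Qed.

(** The approximants are the vectors [e n j]: up to the root of [c n j], [U_n] turns them into the
    [j]-th coordinate of [X_n], so their pairing with [G n] is an instance of weak convergence. *)
Let base_cvg x : range (lim_e (ss_e S)) x -> exists x_ : nat -> H,
  [/\ forall n, ss_H S n (x_ n), x_ n @[n --> \oo] --> x &
    forall a : K, Psi n (a *: x_ n) @[n --> F] --> Phi (a *: x)].
Proof.
move=> [j _ <-].
have jN : \forall n \near \oo, (j < ss_N S n)%N.
  have /(_ [set m | (j < m)%N]) := scale_N_cvg (ss_scale S).
  by apply; exists j.+1.
(* For [j >= N n], which happens for finitely many [n], the value 0 keeps the sequence in [H_n]. *)
exists (fun n => if (j < ss_N S n)%N then ss_e S n j else 0); split.
- move=> n; case: ifPn => [jn|_]; first exact: ss_e_in.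
  by case: (sampling_subspace (ss_sampling S) n).
- have := @scale_e_cvg _ _ _ _ _ _ (ss_scale S) j; apply: cvg_trans; apply: near_eq_cvg.
  by apply: filterS jN => n ->.
move=> a; rewrite PhiZ_lim_e.
have cj0 := scale_lim_c_gt0 (ss_scale S) j.
have c1 : (Num.sqrt (ss_c S n j))^-1 @[n --> \oo] -->
    (Num.sqrt (lim_c (ss_c S) j))^-1.
  apply: cvgV; first by rewrite gt_eqF// sqrtr_gt0.
  apply: (@cvg_comp _ _ _ (fun n => ss_c S n j) Num.sqrt).
    exact: (@scale_c_cvg _ _ _ _ _ _ (ss_scale S) j).
  exact: sqrt_continuous.
have h := cvgM (cvg_finer F_oo c1) (G_weak (bcont_piQ a j)).
apply: (cvg_trans _ (h _)); apply: near_eq_cvg; apply: F_oo.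
apply: filterS jN => n jn; rewrite jn /Psi /= -rsumZ.
apply: eq_rsum => f fO; rewrite piQ_X_n// U_nZ (mulrCA a) ReK_toKM.
have cn0 : Num.sqrt (ss_c S n j) != 0.
  by rewrite gt_eqF// sqrtr_gt0; exact: (scale_c_gt0 (ss_scale S)).
by rewrite (mulrCA _ (G n f)) mulKf.
Qed.

(** An instance of [dense_convergence] on the span of the limit vectors, where weak convergence is
    enough; Cauchy-Schwarz gives the bounds that extend it to all of [H]. *)
Lemma weak_strong (x_ : nat -> H) x : (forall n, ss_H S n (x_ n)) ->
  x_ n @[n --> \oo] --> x ->
  rsum S n (fun f => G n f * ReK (U_n S n (x_ n) f)) @[n --> F] -->
    \int[mu]_q (g q * ReU x q).
Proof.
pose C' := \int[mu]_q (g q ^+ 2); have C'0 : 0 <= C' by exact: Rintegral_sqr_ge0.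
(* One constant that bounds both [Psi n] and [Phi]. *)
pose B := Num.sqrt C + Num.sqrt C'.
apply: (@dense_convergence _ _ _ (ss_H S) _ F FF F_oo Psi Phi B
  (range (lim_e (ss_e S)))) => //.
- exact: (sampling_subspace (ss_sampling S)).
- by rewrite addr_ge0// sqrtr_ge0.
- move=> n y z; rewrite /Psi -rsumD; apply: eq_rsum => f _.
  by rewrite U_nD ReKD mulrDr.
- move=> n y _; apply: le_trans (rsum_ReU_n normH _ C0 (G_le n)) _.
  by rewrite ler_wpM2r ?rnorm_ge0// lerDl sqrtr_ge0.
- move=> y; apply: (@le_trans _ _ (Num.sqrt C' * rnorm y)).
    apply: normr_le_of_sqr => //; first exact: rnorm_ge0.
    apply: le_trans (Cauchy_Schwarz_Rintegral g_sq (sqint_ReUhat y)) _.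
    by rewrite ler_wpM2l// Rintegral_ReUhat_le.
  by rewrite ler_wpM2r ?rnorm_ge0// lerDr sqrtr_ge0.
- exact: (scale_dense (ss_scale S)).
Qed.

End Weak.
End WeakStrong.

(** * Uniqueness *)

(** Compactness of the interval gives a cluster point; an ultrafilter contains each set or its
    complement, hence the values converge to that point. *)
Lemma ultra_bounded_cvg (R : realType) (T : Type) (F : set_system T) (u : T -> R)
    (B : R) : UltraFilter F -> (forall n, `|u n| <= B) -> cvg (u n @[n --> F]).
Proof.
move=> UF uB; have [p [_ clp]] : `[- B, B] `&` cluster (u @ F) !=set0.
  apply: segment_compact; apply: (@filterE _ F) => n /=.
  by rewrite in_itv/= -ler_norml.
apply/cvg_ex; exists p => V pV.
have [//|FV] := in_ultra_setVsetC (u @^-1` V) UF.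
have [x [/= nVx Vx]] : ~` V `&` V !=set0 by exact: clp.
by [].
Qed.

Section AlmostEverywhere.
Context (R : realType) (k : scalar_kind) (mu : probability (borelQ R k) R).

Lemma ae_le_Rintegral (f g : borelQ R k -> R) :
  mu.-integrable setT (EFin \o f) -> mu.-integrable setT (EFin \o g) ->
  (\forall q \ae mu, f q <= g q) -> \int[mu]_q f q <= \int[mu]_q g q.
Proof.
move=> fi gi fg; rewrite -subr_ge0 -RintegralB//.
have mf : measurable_fun setT f by apply/measurable_EFinP; exact: measurable_int fi.
have mg : measurable_fun setT g by apply/measurable_EFinP; exact: measurable_int gi.
(* The absolute value turns nonnegativity almost everywhere into nonnegativity everywhere. *)
rewrite (@ae_eq_Rintegral _ _ _ _ (fun q => `|g q - f q|)).
- exact: Rintegral_ge0.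
- exact: measurable_funB.
- by apply: measurableT_comp => //; exact: measurable_funB.
by apply: filterS fg => q fgq; rewrite ger0_norm// subr_ge0.
Qed.

Lemma Rintegral_eq0_ae (f : borelQ R k -> R) : mu.-integrable setT (EFin \o f) ->
  (forall q, 0 <= f q) -> \int[mu]_q f q = 0 -> \forall q \ae mu, f q = 0.
Proof.
move=> fi f0 If; have := (ae_eq_integral_abs mu measurableT (measurable_int mu fi)).1.
have -> : (\int[mu]_q `|(EFin \o f) q| = 0)%E.
  rewrite -(_ : 0%:E = 0%E)// -If /Rintegral fineK.
    by apply: eq_integral => q _ /=; rewrite ger0_norm.
  exact: integrable_fin_num.
by move=> /(_ erefl); apply: filterS => q /(_ I) [].
Qed.

Lemma integrable_bounded01 (f : borelQ R k -> R) : measurable_fun setT f ->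
  (forall q, 0 <= f q <= 1) -> mu.-integrable setT (EFin \o f).
Proof.
move=> mf f01; apply: sqint_integrable; apply: (@bounded_sqint _ _ _ mu 1) => // q.
by have /andP[h0 h1] := f01 q; rewrite ger0_norm.
Qed.

End AlmostEverywhere.

Section Uniqueness.
Context (R : realType) (k : scalar_kind).
Local Notation K := (scalars R k).
Variables (H : completeNormedModType K) (dot : {dot H for @conjK R k}).
Variables (D : set H) (A : H -> H) (A_dense : dense D).
Variable S : sampling_scale_sequence dot D A.
Hypothesis S_convergent : convergent S.
Variable mu : probability (borelQ R k) R.
Hypothesis mu_associated : associated_measure S mu.
Variable Uhat : H -> {mfun_ mu, borelQ R k >-> borelK R k}.
Hypothesis UhatP : associated_isometry S Uhat.

(** Finite partial sums, so that they are continuous test functions. *)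
Let sqpi J (q : Q R k) : R := \sum_(0 <= j < J) rnorm (piQ j q) ^+ 2.

Let bcont_rnorm_piQ j : bcont (fun q : Q R k => rnorm (piQ j q) ^+ 2).
Proof.
have b : bcont (fun q : Q R k => rnorm (piQ j q)).
  split; last by exists 1 => q; rewrite ger0_norm ?rnorm_ge0// rnorm_piQ.
  move=> q; apply: (@continuous_comp _ _ _ (@piQ R k j) (@rnorm R k K)).
    exact: piQ_continuous.
  exact: rnorm_continuous.
exact: (bcontM b b).
Qed.

Let bcont_sqpi J : bcont (sqpi J).
Proof.
elim: J => [|J IH].
  rewrite (_ : sqpi 0 = fun=> 0); first exact: bcont_cst.
  by apply/funext => q; rewrite /sqpi big_geq.
rewrite (_ : sqpi J.+1 = fun q => 1 * sqpi J q + rnorm (piQ J q) ^+ 2).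
  exact: bcontZD.
by apply/funext => q; rewrite /sqpi big_nat_recr//= mul1r.
Qed.

(** The squared moduli of all coordinates of [X_n f] add up to [mass / mass = 1], those with
    [j >= N_n] being 0. *)
Let sqpi_X_n J n f : f \in ss_Omega S n -> sqpi J (X_n S n f) <= 1.
Proof.
move=> fO; have m0 := mass_gt0 fO.
(* The longer sum includes every coordinate that can be nonzero. *)
apply: (@le_trans _ _ (sqpi (J + ss_N S n) (X_n S n f))).
  rewrite /sqpi [leRHS](@big_cat_nat _ _ _ J)/= ?leq_addr// lerDl.
  by apply: sumr_ge0 => j _; exact: sqr_ge0.
rewrite /sqpi (@big_cat_nat _ _ _ (ss_N S n))/= ?leq_addl//.
rewrite [X in _ + X]big1_seq ?addr0; last first.
  move=> j /=; rewrite mem_index_iota => /andP[Nj _].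
  by rewrite /piQ /X_n set_valE /= /coord_X ltnNge Nj /= rnorm0 expr0n.
rewrite big_mkord le_eqVlt; apply/orP; left; apply/eqP.
transitivity (mass S n f / mass S n f); last by rewrite divff// gt_eqF.
rewrite {1}/mass mulr_suml; apply: eq_bigr => j _.
have c0 := ltW (scale_c_gt0 (ss_scale S) (ltn_ord j)).
rewrite piQ_X_n// rnormM rnorm_toK ger0_norm ?sqrtr_ge0// exprMn sqr_sqrtr//.
rewrite /U_n rnormM -toKV rnorm_toK ger0_norm ?invr_ge0 ?sqrtr_ge0//.
by rewrite exprMn exprVn sqr_sqrtr ?mass_ge0// mulrA.
Qed.

(** The positive part of [sqpi J - 1] is a test function that vanishes on the image of [Omega_n] for
    every [n], so its integral against [mu] is 0. *)
Let sqpi_le1 J : \forall q \ae mu, sqpi J q <= 1.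
Proof.
pose h q : R := Num.max 0 (sqpi J q - 1).
have [cs [M hM]] := bcont_sqpi J.
have bh : bcont h.
  split.
    move=> q; apply: (@continuous_max _ _ (cst 0) (fun q => sqpi J q - 1)).
      exact: cst_continuous.
    by apply: (@cvgB _ _ _ (nbhs q)); [exact: cs|exact: cvg_cst].
  exists (M + 1) => q; rewrite ger0_norm ?le_max ?lexx//.
  rewrite ge_max; have := hM q; have := ler_norm (sqpi J q).
  have := normr_ge0 (sqpi J q); lra.
have h0 : \int[mu]_q h q = 0.
  have := rsum_cvg S_convergent mu_associated bh.
  rewrite (_ : (fun n => _) = fun=> 0); last first.
    apply/funext => n; rewrite /rsum big_seq big1// => f fO /=.
    by rewrite /h max_l ?mulr0// subr_le0 sqpi_X_n.
  by move=> /(cvg_lim (@Rhausdorff R)) <-; rewrite lim_cst.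
have hge q : 0 <= h q by rewrite le_max lexx.
have := Rintegral_eq0_ae (sqint_integrable (bcont_sqint mu bh)) hge h0.
apply: filterS => q hq.
have : sqpi J q - 1 <= h q by rewrite le_max lexx orbT.
by rewrite hq subr_le0.
Qed.

Let rnorm_piQ_ae j : \forall q \ae mu, rnorm (piQ j q) ^+ 2 =
  lim_c (ss_c S) j * rnorm (Uhat (lim_e (ss_e S) j) q : K) ^+ 2.
Proof.
have c0 := scale_lim_c_gt0 (ss_scale S) j.
apply: filterS (isometry_V UhatP j) => q ->.
rewrite rnormM -toKV rnorm_toK ger0_norm ?invr_ge0 ?sqrtr_ge0// exprMn exprVn.
by rewrite sqr_sqrtr ?ltW// mulVKf// gt_eqF.
Qed.

(** By the isometry, [pi_j] being a multiple of the image of the [j]-th limit vector. The scale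
    condition makes these sums tend to 1. *)
Let Rintegral_sqpi J : \int[mu]_q sqpi J q =
  \sum_(0 <= j < J) lim_c (ss_c S) j * rnorm (lim_e (ss_e S) j) ^+ 2.
Proof.
elim: J => [|J IH].
  rewrite big_geq// -(Rintegral_cst_setT mu 0); apply: eq_Rintegral => q _.
  by rewrite /sqpi big_geq.
rewrite big_nat_recr//= -IH.
have bi h (bh : bcont h) := sqint_integrable (bcont_sqint mu bh).
transitivity (\int[mu]_q (sqpi J q + rnorm (piQ J q) ^+ 2)).
  by apply: eq_Rintegral => q _; rewrite /sqpi big_nat_recr.
rewrite RintegralD//; [|exact: bi..]; congr (_ + _).
rewrite -(Rintegral_rnormUhat UhatP) -RintegralZl//; last first.
  exact: (sqint_rnormUhat UhatP _).2.
apply: ae_eq_Rintegral; last exact: rnorm_piQ_ae.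
  exact: bcont_measurable.
by apply: measurable_funM => //; apply: measurable_funX; exact: rnormUhat_measurable.
Qed.

(* In the application, [phi] is [min 1 |m - m'|] for two multipliers [m], [m']. *)
Variable phi : borelQ R k -> R.
Hypothesis phi_measurable : measurable_fun setT phi.
Hypothesis phi01 : forall q, 0 <= phi q <= 1.
Hypothesis phi_D : forall x, D x ->
  \forall q \ae mu, phi q * rnorm (Uhat x q : K) = 0.

Let phi_sqint y :
  mu.-integrable setT (EFin \o (fun q => phi q * rnorm (Uhat y q : K) ^+ 2)).
Proof.
have h := (sqint_rnormUhat UhatP y); apply: (le_integrable measurableT _ _ h.2).
  apply/measurable_EFinP/measurable_funM => //; apply: measurable_funX.
  exact: rnormUhat_measurable.
move=> q _ /=; have /andP[p0 p1] := phi01 q.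
rewrite lee_fin (ger0_norm (mulr_ge0 p0 (sqr_ge0 _))) (ger0_norm (sqr_ge0 _)).
by rewrite ler_piMl ?sqr_ge0.
Qed.

(** For [x] in [D], almost everywhere [phi] or [Uhat x] is 0, so [Uhat y] may be replaced by
    [Uhat (y - x)]; the integral is then at most the square norm of [y - x], which density makes
    arbitrarily small. *)
Let phi_Uhat y : \forall q \ae mu, phi q * rnorm (Uhat y q : K) ^+ 2 = 0.
Proof.
have pge q : 0 <= phi q * rnorm (Uhat y q : K) ^+ 2.
  by have /andP[p0 _] := phi01 q; rewrite mulr_ge0 ?sqr_ge0.
apply: (Rintegral_eq0_ae (phi_sqint y) pge); apply/le_anti.
rewrite Rintegral_ge0// andbT; apply/ler_addgt0Pr => e e0; rewrite add0r.
have s0 : 0 < Num.sqrt e by rewrite sqrtr_gt0.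
have [x [/= yx Dx]] : [set x | rnorm (y - x) < Num.sqrt e] `&` D !=set0.
  apply: A_dense; first by exists y; rewrite /= subrr rnorm0.
  rewrite openE => x /= xy; apply: (@cvgr_lt _ _ (nbhs x) _ _ (rnorm (y - x))) => //.
  apply: (@continuous_comp _ _ _ (fun x : H => y - x) (@rnorm R k H)).
    by apply: (@cvgB _ _ _ (nbhs x)); [exact: cvg_cst|exact: cvg_id].
  exact: rnorm_continuous.
apply: (@le_trans _ _ (rnorm (y - x) ^+ 2)); last first.
  by rewrite -(sqr_sqrtr (ltW e0)) lerXn2r ?nnegrE ?rnorm_ge0 ?sqrtr_ge0// ltW.
rewrite -(Rintegral_rnormUhat UhatP); apply: ae_le_Rintegral => //.
  exact: (sqint_rnormUhat UhatP _).2.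
have := UhatD UhatP (y - x) x; rewrite subrK => hy.
apply: filterS2 hy (phi_D Dx) => q -> /eqP; rewrite mulf_eq0.
have /andP[p0 p1] := phi01 q.
case/orP => /eqP h0; first by rewrite h0 mul0r sqr_ge0.
have -> : Uhat x q = 0 :> K.
  by apply/eqP; rewrite -normr_eq0 toK_rnorm h0 toK0.
by rewrite addr0 ler_piMl ?sqr_ge0.
Qed.

(** Where [phi] is nonzero all coordinates vanish, so [sqpi J <= 1 - phi] almost everywhere.
    Integrating and letting [J] tend to infinity gives 1 at most 1 minus the integral of [phi]. *)
Lemma multiplier_kernel : \forall q \ae mu, phi q = 0.
Proof.
have iphi := integrable_bounded01 mu phi_measurable phi01.
have bi h (bh : bcont h) := sqint_integrable (bcont_sqint mu bh).
have p_pi j : \forall q \ae mu, phi q * rnorm (piQ j q) ^+ 2 = 0.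
  apply: (@filterS2 (borelQ R k) (almost_everywhere mu) _ _ _ _ _
    (rnorm_piQ_ae j) (phi_Uhat (lim_e (ss_e S) j))) => q -> h.
  by rewrite mulrCA h mulr0.
have le1 J : \sum_(0 <= j < J) lim_c (ss_c S) j * rnorm (lim_e (ss_e S) j) ^+ 2
    <= 1 - \int[mu]_q phi q.
  rewrite -Rintegral_sqpi -(Rintegral_cst_setT mu 1) -RintegralB//; last first.
    exact: bi (bcont_cst _ 1).
  apply: ae_le_Rintegral; first exact: bi.
    exact: (integrableB measurableT (bi (fun=> 1) (bcont_cst _ _)) iphi).
  apply: filterS2 (ae_foralln p_pi) (sqpi_le1 J) => q hq s1.
  have [->|p0] := eqVneq (phi q) 0; first by rewrite subr0.
  rewrite /sqpi big1 ?subr_ge0; first by have /andP[] := phi01 q.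
  by move=> j _; have /eqP := hq j; rewrite mulf_eq0 (negbTE p0) => /eqP.
apply: (Rintegral_eq0_ae iphi); first by move=> q; have /andP[] := phi01 q.
apply/le_anti/andP; split; last first.
  by apply: Rintegral_ge0 => q _; have /andP[] := phi01 q.
have : 1 <= 1 - \int[mu]_q phi q.
  apply: (cvgr_to_le (scale_series (ss_scale S))).
  by apply: nearW => J; exact: le1.
lra.
Qed.

End Uniqueness.

(** * Existence *)

Lemma aeI (R : realType) (k : scalar_kind) (mu : probability (borelQ R k) R)
    (P1 P2 : borelQ R k -> Prop) :
  (\forall q \ae mu, P1 q) -> (\forall q \ae mu, P2 q) ->
  \forall q \ae mu, P1 q /\ P2 q.
Proof. by move=> h1 h2; apply: filterS2 h1 h2 => q. Qed.

Section Existence.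
Context (R : realType) (k : scalar_kind).
Local Notation K := (scalars R k).
Variables (H : completeNormedModType K) (dot : {dot H for @conjK R k}).
Hypothesis normH : forall x : H, dot x x = `|x| ^+ 2.
Variables (D : set H) (A : H -> H) (A_linear : linear_on D A).
Variable S : sampling_scale_sequence dot D A.
Hypothesis S_convergent : convergent S.
Variable mu : probability (borelQ R k) R.
Hypothesis mu_associated : associated_measure S mu.

(** The ultrafilter provides limits for all test functions at once, in place of a diagonal
    extraction of subsequences. *)
Lemma eigenval_weak_limit : exists F : set_system nat,
  [/\ ProperFilter F, \oo `<=` F & exists2 m : borelQ R k -> R, sqint mu m &
    forall h, bcont h ->
      rsum S n (fun f => eigenval S n f * h (X_n S n f)) @[n --> F] -->
      \int[mu]_q (m q * h q)].
Proof.
have [F [UF F_oo]] := ultraFilterLemma eventually_filter.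
have FF : ProperFilter F by exact: ultra_proper.
exists F; split => //.
have [C C0 eC] := rsum_eigenval_bounded normH S.
pose u h n := rsum S n (fun f => eigenval S n f * h (X_n S n f)).
have u_le h n : u h n ^+ 2 <= C * rsum S n (fun f => h (X_n S n f) ^+ 2).
  apply: le_trans (Cauchy_Schwarz_rsum _ _ _ _) _.
  by rewrite ler_wpM2r ?rsum_sqr_ge0.
have u_cvg h : bcont h -> cvg (u h n @[n --> F]).
  move=> [_ [M hM]]; have M0 : 0 <= M := le_trans (normr_ge0 _) (hM point).
  apply: (@ultra_bounded_cvg _ _ _ _ (Num.sqrt C * M)) => n.
  apply: normr_le_of_sqr => //; apply: le_trans (u_le h n) _.
  rewrite ler_wpM2l//.
  have := rsum_sqrM_le S n (fun=> 1) M0 (fun f => hM (X_n S n f)).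
  have := rsum1_le1 normH S n.
  set a := rsum S n (fun=> 1 ^+ 2) => a1.
  have -> : rsum S n (fun f => (1 * h (X_n S n f)) ^+ 2) =
      rsum S n (fun f => h (X_n S n f) ^+ 2).
    by apply: eq_rsum => f _; rewrite mul1r.
  by move=> /le_trans; apply; rewrite ler_piMr ?sqr_ge0.
pose L h := lim (u h n @[n --> F]).
have L_ZD (a : R) f g : bcont f -> bcont g ->
    L (fun q => a * f q + g q) = a * L f + L g.
  move=> bf bg; apply: (cvg_lim (@Rhausdorff R)).
  have -> : (u (fun q => a * f q + g q)) = fun n => a * u f n + u g n.
    apply/funext => n; rewrite /u -rsumZD; apply: eq_rsum => x _; ring.
  by apply: cvgD; [apply: cvgM; [exact: cvg_cst|exact: u_cvg]|exact: u_cvg].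
(* The bound passes to the limit because the [mu_n] integrals of [h ^ 2] tend to the integral
   against [mu]; this is the boundedness that the Riesz representation asks for. *)
have L_le h : bcont h -> L h ^+ 2 <= C * \int[mu]_q (h q ^+ 2).
  move=> bh; rewrite -subr_ge0.
  apply: (@cvgr_to_ge _ F _ _
    (fun n => C * rsum S n (fun f => h (X_n S n f) ^+ 2) - u h n ^+ 2)); last first.
    by apply: nearW => n; rewrite subr_ge0.
  apply: cvgB; last by apply: cvgM; exact: u_cvg.
  apply: cvgM; first exact: cvg_cst.
  apply: (cvg_finer F_oo).
  exact: (rsum_cvg S_convergent mu_associated (bcontM bh bh)).
have [m sm mL] := @Riesz_sqint _ _ _ mu (@bcont R k) L C C0
  (bcont_cst k 0) (@bcontZD R k) (bcont_sqint mu) L_ZD L_le.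
by exists m => // h bh; rewrite mL//; exact: u_cvg.
Qed.

Variable Uhat : H -> {mfun_ mu, borelQ R k >-> borelK R k}.
Hypothesis UhatP : associated_isometry S Uhat.

Lemma real_multiplier : exists2 m : borelQ R k -> R, sqint mu m &
  forall x, D x -> \forall q \ae mu, Uhat (A x) q = toK (m q) * (Uhat x q : K).
Proof.
have [F [FF F_oo [m sm mF]]] := eigenval_weak_limit.
exists m => //.
have [C C0 eC] := rsum_eigenval_bounded normH S.
have sReU x := sqint_ReUhat UhatP x.
(* The identity for real parts, obtained by testing the difference against every bounded continuous
   [h]. *)
have key x : D x -> \forall q \ae mu, ReK (Uhat (A x) q : K) = m q * ReK (Uhat x q : K).
  move=> Dx; have [x_ [Hx xx Axx]] := sampling_graph (ss_sampling S) Dx.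
  suff : \forall q \ae mu, ReK (Uhat (A x) q : K) - m q * ReK (Uhat x q : K) = 0.
    by apply: filterS => q /eqP; rewrite subr_eq0 => /eqP.
  have i1 := sqint_integrable (sReU (A x)); have i2 := sqintM sm (sReU x).
  apply: bcont_vanish_ae; first exact: (integrableB measurableT i1 i2).
  move=> h bh; have sh := bcont_sqint mu bh.
  have [_ [M hM]] := bh; have M0 : 0 <= M := le_trans (normr_ge0 _) (hM point).
  have smh : sqint mu (fun q => m q * h q).
    have := sqintMb (bcont_measurable bh) hM sm.
    by under eq_fun do rewrite mulrC.
  (* The weak factor is [h] composed with [X_n], the strong one [A_n (x_ n)]. *)
  have c1 : rsum S n (fun f => h (X_n S n f) * ReK (U_n S n (ss_A S n (x_ n)) f))
      @[n --> F] --> \int[mu]_q (h q * ReK (Uhat (A x) q : K)).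
    apply: (@weak_strong _ _ _ _ normH _ _ _ _ _ UhatP F FF F_oo
      (fun n f => h (X_n S n f)) h (M ^+ 2)) => //.
    - exact: sqr_ge0.
    - move=> n; rewrite -[leRHS]mulr1; have := rsum1_le1 normH S n => r1.
      have := rsum_sqrM_le S n (fun=> 1) M0 (fun f => hM (X_n S n f)).
      rewrite (@eq_rsum _ _ _ _ _ _ S n _ (fun f => h (X_n S n f) ^+ 2)).
        by move=> /le_trans; apply; rewrite ler_wpM2l ?sqr_ge0.
      by move=> f _; rewrite mul1r.
    - move=> h' bh'; apply: (cvg_finer F_oo).
      exact: (rsum_cvg S_convergent mu_associated (bcontM bh bh')).
    - by move=> n; apply: (sampling_stable (ss_sampling S)).
  (* The eigenvalue moves to the weak factor, whose weak limit is [m * h]; the strong factor is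
     [x_ n]. *)
  have c2 : rsum S n (fun f => (eigenval S n f * h (X_n S n f)) *
      ReK (U_n S n (x_ n) f)) @[n --> F] -->
      \int[mu]_q ((m q * h q) * ReK (Uhat x q : K)).
    apply: (@weak_strong _ _ _ _ normH _ _ _ _ _ UhatP F FF F_oo
      (fun n f => eigenval S n f * h (X_n S n f)) (fun q => m q * h q)
      (M ^+ 2 * C)) => //.
    - by rewrite mulr_ge0 ?sqr_ge0.
    - move=> n; apply: le_trans (rsum_sqrM_le _ _ _ M0 _) _ => //.
      by rewrite ler_wpM2l ?sqr_ge0.
    - move=> h' bh'; have := mF _ (bcontM bh bh').
      under eq_fun do under eq_fun do rewrite mulrA.
      by under eq_Rintegral do rewrite mulrA.
  (* [U_n] diagonalizes [A_n], so the two sequences coincide and so do their limits. *)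
  have E : (fun n => rsum S n (fun f => h (X_n S n f) * ReK (U_n S n (ss_A S n (x_ n)) f)))
      = (fun n => rsum S n (fun f => (eigenval S n f * h (X_n S n f)) *
      ReK (U_n S n (x_ n) f))).
    apply/funext => n; apply: eq_rsum => f fO.
    by rewrite U_n_eigenval// ReK_toKM; ring.
  rewrite E in c1; have e12 := cvg_unique (@Rhausdorff R) c1 c2.
  transitivity (\int[mu]_q (h q * ReK (Uhat (A x) q : K) -
      (m q * h q) * ReK (Uhat x q : K))).
    by apply: eq_Rintegral => q _; ring.
  by rewrite RintegralB ?e12 ?subrr//; exact: sqintM.
move=> x Dx.
(* The identity of real parts at [imK *: x] supplies the imaginary part. *)
have Dix : D (imK *: x).
  by rewrite -[_ *: _]addr0; apply: A_linear.1.2 => //; exact: A_linear.1.1.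
have AiE : A (imK *: x) = imK *: A x.
  have A0 : A 0 = 0.
    have := A_linear.2 1 0 0 A_linear.1.1 A_linear.1.1.
    by rewrite !scale1r addr0 => h; apply: (addrI (A 0)); rewrite -h addr0.
  by rewrite -[imK *: x]addr0 A_linear.2 ?A0 ?addr0//; exact: A_linear.1.1.
have k2 := key _ Dix; rewrite AiE in k2.
have k3 := UhatZ UhatP imK (A x); have k4 := UhatZ UhatP imK x.
apply: filterS (aeI (aeI (key _ Dx) k2) (aeI k3 k4)) => q [[h1 h2] [h3 h4]].
apply/eqP; rewrite -subr_eq0; apply/eqP; apply: ReK_imK_eq0.
  by rewrite ReKB ReK_toKM h1 subrr.
by rewrite mulrBr ReKB mulrCA ReK_toKM -h3 -h4 h2 subrr.
Qed.

End Existence.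

(** * The multiplier as a class modulo null sets *)

Theorem theorem6p1 (R : realType) (k : scalar_kind)
    (H : completeNormedModType (scalars R k)) (dot : {dot H for @conjK R k})
    (normH : forall x : H, dot x x = `|x| ^+ 2)
    (H_separable : separable H)
    (D : set H) (A : H -> H)
    (A_linear : linear_on D A) (A_dense : dense D)
    (A_symmetric : symmetric_on dot D A)
    (S : sampling_scale_sequence dot D A)
    (S_convergent : convergent S)
    (mu : probability (borelQ R k) R)
    (mu_associated : associated_measure S mu)
    (Uhat : H -> {mfun_ mu, borelQ R k >-> borelK R k})
    (Uhat_associated : associated_isometry S Uhat) :
  exists! m : {mfun_ mu, borelQ R k >-> borelK R k},
    [/\ L2 m, L2_real_valued m &
      forall x, D x ->
        \forall q \ae mu,
          Uhat (A x) q = (m q : scalars R k) * (Uhat x q : scalars R k)].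
Proof.
have [m0 [mm0 im0] m0P] :=
  real_multiplier normH A_linear S_convergent mu_associated Uhat_associated.
have mtm : measurable_fun setT (fun q => toK (m0 q) : borelK R k).
  by apply: measurableT_comp => //; exact: toK_measurable.
pose tm : {mfun borelQ R k >-> borelK R k} :=
  HB.pack (fun q => toK (m0 q) : borelK R k)
    (isMeasurableFun.Build _ _ _ _ _ mtm).
pose m : {mfun_ mu, borelQ R k >-> borelK R k} := (\pi tm)%qT.
(* The representative chosen for the class agrees with the given function only almost everywhere. *)
have m_tm : \forall q \ae mu, m q = toK (m0 q) :> scalars R k.
  have : tm = repr m %[mod {mfun_ mu, borelQ R k >-> borelK R k}]%qT.
    by rewrite reprK.
  move=> /eqmodP/asboolP; apply: filterS => q /(_ I) h; exact: esym h.
exists m; split.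
  split.
  - rewrite /L2 /= (_ : (\int[mu]_q _ = \int[mu]_q (m0 q ^+ 2)%:E)%E).
      by rewrite (sqint_integral (conj mm0 im0)) ltry.
    apply: ae_eq_integral => //.
    + apply/measurable_EFinP/measurable_funX.
      exact: (mfun_comp_measurable _ (@rnorm_continuous R k (scalars R k))).
    + by apply/measurable_EFinP/measurable_funX.
    by apply: filterS m_tm => q -> _; rewrite rnorm_toK real_normK ?num_real.
  - by apply: filterS m_tm => q ->; exists (m0 q).
  - by move=> x Dx; apply: filterS2 m_tm (m0P x Dx) => q -> ->.
move=> m' [m'L2 m'R m'P].
pose r q : R := ReK (m' q : scalars R k).
have mr : measurable_fun setT r.
  exact: (mfun_comp_measurable _ (@ReK_continuous R k)).
(* Truncation at 1 keeps [phi] in the unit interval without changing where it vanishes. *)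
pose phi q := Num.min 1 `|m0 q - r q|.
have mphi : measurable_fun setT phi.
  apply: measurable_minr => //; apply: measurableT_comp => //.
  exact: measurable_funB.
have phi01 q : 0 <= phi q <= 1.
  by rewrite /phi le_min ler01 normr_ge0 ge_min lexx.
have phiD x : D x -> \forall q \ae mu, phi q * rnorm (Uhat x q : scalars R k) = 0.
  move=> Dx; apply: filterS2 (m0P x Dx) (m'P x Dx) => q -> h.
  (* Where [Uhat x] is nonzero it cancels, so the multipliers agree and [phi] is 0. *)
  have [->|U0] := eqVneq (Uhat x q : scalars R k) 0; first by rewrite rnorm0 mulr0.
  have {}h := mulIf U0 h.
  by rewrite /phi /r -h toKK subrr normr0 min_r// mul0r.
have phi0 := multiplier_kernel A_dense S_convergent mu_associated
  Uhat_associated mphi phi01 phiD.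
rewrite -[m]reprK -[m']reprK; apply/eqmodP/asboolP.
apply: filterS (aeI (aeI m_tm m'R) phi0) => q [[h1 [r' h2]] h3] _.
(* Both classes are real at [q], so the comparison reduces to [m0] and the real part of [m']. *)
rewrite -[LHS]/(m q) -[RHS]/(m' q) h1 h2; congr toK.
have : `|m0 q - r q| <= 0.
  move: h3; rewrite /phi /Num.min; case: ifP => [_ /eqP|_ ->//].
  by rewrite oner_eq0.
by rewrite normr_le0 subr_eq0 /r h2 toKK => /eqP.
Qed.
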